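(* Assume (A1)–(A5). Let $k\in\mathbb{Z}^+$. Then there exists a probability mass function $\mathbb{P}_L$ on $\mathbb{Z}^+$ with $\mathbb{P}_L(l)>0$ for all $l$ such that the following holds. Let $L\sim\mathbb{P}_L$ be independent of the level-0 chain and of all increment chains $(Z_{n,l,l-1})_{n}$, $l\ge 1$. Then for every bounded measurable $\varphi\in\mathrm{Lip}_{\tilde{\mathsf d}}(\mathsf X)$ the single-term estimator $$\widehat{\pi(\varphi)}_{S,k}:=\frac{1}{\mathbb{P}_L(L)}\Big(\mathbb{I}_{\{L=0\}}\,\widehat{\pi_0(\varphi)}_k+\mathbb{I}_{\{L\ge 1\}}\,\xi_{L,k}\Big)$$ satisfies $\mathbb{E}[\widehat{\pi(\varphi)}_{S,k}]=\pi(\varphi)$ and $\mathbb{E}[\widehat{\pi(\varphi)}_{S,k}^2]<\infty$.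
   Context: Setting. $(\mathsf X,\mathcal X)$ is a measurable space with $\mathsf X$ compact. $\tilde{\mathsf d}$ is a measurable metric on $\mathsf X$ with $\sup_{x,w\in\mathsf X}\tilde{\mathsf d}(x,w)<\infty$. $\pi$ and $(\pi_l)_{l\in\mathbb{Z}^+}$ are probability measures on $\mathsf X$, and $\Delta_l:=2^{-l}$. For each $l\in\mathbb{Z}^+$, $K_l$ is a Markov kernel on $\mathsf X$ with $\pi_lK_l=\pi_l$, and $\nu_l$ is a probability measure on $\mathsf X$. For a Markov kernel $K$ and bounded measurable $\varphi$, $K(\varphi)(x)=\int\varphi(x')K(x,dx')$, $K^n$ is the $n$-fold iterated kernel ($K^0$ the identity), and $\mu(\varphi)=\int\varphi\,d\mu$. $\|\mu-\nu\|_{tv}=\sup_{A\in\mathcal X}|\mu(A)-\nu(A)|$. $\|\varphi\|_\infty=\sup_x|\varphi(x)|$; $\mathrm{Lip}_{\tilde{\mathsf d}}(\mathsf X)$ is the set of $\varphi:\mathsf X\to\mathbb R$ with $|\varphi(x)-\varphi(w)|\le c\,\tilde{\mathsf d}(x,w)$ for some $c<\infty$ and all $x,w$, and $\|\varphi\|_{\mathrm{Lip}}$ is the smallest such $c$. $\mathbb{Z}^+=\{0,1,2,\dots\}$, $\mathbb N=\{1,2,\dots\}$. For $s\in\mathbb{Z}^+$, let $\tilde\nu_s$ be a probability measure on $\mathsf X^2$ both of whose marginals equal $\nu_s$, and let $\check\nu_s(d(x,w)):=\int\tilde\nu_s(d(x',w'))K_s(x',dx)\delta_{w'}(dw)$.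 Level-0 chain. $(X_{n,0},W_{n,0})_{n\ge0}$ is a Markov chain on $\mathsf X^2$ with initial law $\check\nu_0$ and transition kernel $\check K_0$, where $\check K_0((x,w),\cdot)$ is a probability measure on $\mathsf X^2$ with first marginal $K_0(x,\cdot)$ and second marginal $K_0(w,\cdot)$. Its meeting time is $\tau_0=\inf\{n\ge1:X_{n,0}=W_{n,0}\}$, and the chain is faithful: $X_{n,0}=W_{n,0}$ for all $n\ge\tau_0$. Increment chains. For each $l\in\mathbb N$, $(Z_{n,l,l-1})_{n\ge0}$ with $Z_{n,l,l-1}=((X_{n,l},W_{n,l}),(X_{n,l-1},W_{n,l-1}))$ is a Markov chain on $\mathsf X^4$ with transition kernel $\check K_{l,l-1}$ such that for every $z=((x_l,w_l),(x_{l-1},w_{l-1}))\in\mathsf X^4$ and $s\in\{l,l-1\}$, the image of $\check K_{l,l-1}(z,\cdot)$ under the coordinate $x_s'$ is $K_s(x_s,\cdot)$ and under the coordinate $w_s'$ is $K_s(w_s,\cdot)$; its initial law $\check\nu_{l,l-1}$ is such that, for each $s\in\{l,l-1\}$, $(X_{0,s},W_{0,s})$ has law $\check\nu_s$. Meeting times: $\tau_s=\inf\{n\ge1:X_{n,s}=W_{n,s}\}$ for $s\in\{l,l-1\}$, $\check\tau_{l,l-1}=\tau_l\vee\tau_{l-1}$, and faithfulness holds: $X_{n,s}=W_{n,s}$ for all $n\ge\tau_s$. Chains for different $l$ (and the level-0 chain) are independent. Estimators. For $k\in\mathbb Z^+$ and bounded measurable $\varphi$: $\widehat{\pi_s(\varphi)}_k:=\varphi(X_{k,s})+\sum_{n=k+1}^{\tau_s-1}\{\varphi(X_{n,s})-\varphi(W_{n,s})\}$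 (empty sums are $0$), computed from the level-0 chain when $s=0$ and from the chain $(Z_{n,l,l-1})$ when $s\in\{l,l-1\}$; and $\xi_{l,k}:=\widehat{\pi_l(\varphi)}_k-\widehat{\pi_{l-1}(\varphi)}_k$, both terms computed from $(Z_{n,l,l-1})_n$. Assumptions. (A1) There exist $C<\infty$, $\rho\in(0,1)$ with $\sup_{l\in\mathbb Z^+}\sup_{x\in\mathsf X}\|K_l^n(x,\cdot)-\pi_l\|_{tv}\le C\rho^n$ for all $n\in\mathbb N$. (A2) There exist $C<\infty$, $\rho\in(0,1)$ such that for all $n\in\mathbb N$: $\mathbb P(\tau_0>n)\le C\rho^n$, and for all $l\in\mathbb N$ and $s\in\{l,l-1\}$ the meeting time $\tau_s$ of the chain $(Z_{n,l,l-1})_n$ satisfies $\mathbb P(\tau_s>n)\le C\rho^n$. (A3) There exists $C<\infty$ such that for all $l\in\mathbb Z^+$, all bounded $\varphi\in\mathrm{Lip}_{\tilde{\mathsf d}}(\mathsf X)$ and all $x,w\in\mathsf X$: $|K_l(\varphi)(x)-K_l(\varphi)(w)|\le C(\|\varphi\|_\infty\vee\|\varphi\|_{\mathrm{Lip}})\tilde{\mathsf d}(x,w)$. (A4) There exist $C<\infty$, $\beta_1>0$ such that for all $l\in\mathbb N$ and bounded measurable $\varphi$: (i) $|\pi_l(\varphi)-\pi(\varphi)|\le C\|\varphi\|_\infty\Delta_l^{\beta_1}$; (ii) $\sup_{x}|K_l(\varphi)(x)-K_{l-1}(\varphi)(x)|\le C\|\varphi\|_\infty\Delta_l^{\beta_1}$.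 (A5) There exist $C<\infty$, $\beta_2>0$, $\epsilon>0$ such that, with $B_l:=\{(x_1,x_2,x_3,x_4)\in\mathsf X^4:\tilde{\mathsf d}(x_i,x_j)\le C\Delta_l^{\beta_2}\ \forall i,j\}$, for all $l,n\in\mathbb N$: $\mathbb P(Z_{0,l,l-1}\notin B_l)\le C\Delta_l^{\beta_2(2+\epsilon)}$ and $\mathbb P(Z_{n,l,l-1}\notin B_l,\ Z_{n-1,l,l-1}\in B_l)\le C\Delta_l^{\beta_2(2+\epsilon)}$. *)

(* Defs.v *)
From HB Require Import structures.
From mathcomp Require Import all_boot all_order all_algebra.
From mathcomp Require Import all_classical all_reals all_analysis.
Set Implicit Arguments.
Unset Strict Implicit.
Unset Printing Implicit Defensive.
Import Order.TTheory GRing.Theory Num.Theory.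
Import numFieldNormedType.Exports.
Local Open Scope classical_set_scope.
Local Open Scope ring_scope.

Section defs.
Context (R : realType).

Definition is_metric {T : Type} (d : T -> T -> R) : Prop :=
  [/\ forall x y, 0 <= d x y,
      forall x y, d x y = 0 <-> x = y,
      forall x y, d x y = d y x &
      forall x y z, d x z <= d x y + d y z].

(** compactness of (T, d): every sequence has a d-convergent subsequence
    (for metric spaces this is compactness) *)
Definition metric_compact {T : Type} (d : T -> T -> R) : Prop :=
  forall u : nat -> T, exists (phi : nat -> nat) (x : T),
    (forall n, (phi n < phi n.+1)%N) /\
    ((fun n => d (u (phi n)) x) @ \oo --> (0 : R)).

Definition sup_norm {T : Type} (f : T -> R) : R := sup (range (fun x => `|f x|)).

Definition is_lipschitz {T : Type} (d : T -> T -> R) (f : T -> R) : Prop :=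
  exists c : R, forall x w, `|f x - f w| <= c * d x w.

Definition lip_norm {T : Type} (d : T -> T -> R) (f : T -> R) : R :=
  inf [set c : R | 0 <= c /\ forall x w, `|f x - f w| <= c * d x w].

Definition is_bounded_fun {T : Type} (f : T -> R) : Prop :=
  exists M : R, forall x, `|f x| <= M.

Definition Delta_pow (l : nat) (beta : R) : R := ((2 : R) ^- l) `^ beta.

Section kernels.
Context {d : measure_display} {S : measurableType d}.

Definition kapp (K : R.-pker S ~> S) (f : S -> R) (x : S) : \bar R :=
  (\int[K x]_y (f y)%:E)%E.

Fixpoint kiter (K : R.-pker S ~> S) (n : nat) (x : S) (A : set S) : \bar R :=
  match n with
  | 0 => (\1_A x)%:E
  | m.+1 => (\int[K x]_y kiter K m y A)%E
  end.

Fixpoint fdd (K : R.-pker S ~> S) (As : seq (set S)) (z : S) : \bar R :=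
  match As with
  | [::] => 1%E
  | A :: As' => (\int[K z]_y ((\1_A y)%:E * fdd K As' y))%E
  end.
End kernels.

Section process.
Context {dO : measure_display} {Omega : measurableType dO} (P : probability Omega R).

(** (Z_n) is a Markov chain with transition kernel K (its initial law being
    the law of Z_0 under P): finite dimensional distributions on rectangles *)
Definition markov_chain {d : measure_display} {S : measurableType d}
    (Z : nat -> Omega -> S) (K : R.-pker S ~> S) : Prop :=
  (forall n, measurable_fun setT (Z n)) /\
  forall (A0 : set S) (As : seq (set S)),
    measurable A0 -> (forall i, (i < size As)%N -> measurable (nth setT As i)) ->
    P [set w | A0 (Z 0%N w) /\
               forall i, (i < size As)%N -> nth setT As i (Z i.+1 w)]
    = (\int[P]_w ((\1_A0 (Z 0%N w))%:E * fdd K As (Z 0%N w)))%E.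

Definition proc_events {d : measure_display} {S : measurableType d}
    (Z : nat -> Omega -> S) : set (set Omega) :=
  smallest (sigma_algebra setT)
    [set E | exists n (A : set S), measurable A /\ E = Z n @^-1` A].

Definition mutually_independent {I : eqType} (F : I -> set (set Omega)) : Prop :=
  forall (J : seq I) (E : I -> set Omega), uniq J ->
    (forall j, j \in J -> F j (E j)) ->
    P (\big[setI/setT]_(j <- J) E j) = (\prod_(j <- J) fine (P (E j)))%:E.

Definition family_events {I : Type} (F : I -> set (set Omega)) : set (set Omega) :=
  smallest (sigma_algebra setT) (\bigcup_(i in setT) F i).
End process.

Section estim.
Context {Omega : Type} {T : Type}.

(** tau = inf {n >= 1 : X_n = W_n}; by convention 0 if the set is empty *)
Definition meet_time (X W : nat -> Omega -> T) (w : Omega) : nat :=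
  xget 0%N [set n | (0 < n)%N /\ X n w = W n w /\
                    forall m, (0 < m < n)%N -> X m w <> W m w].

Definition meet_gt (X W : nat -> Omega -> T) (n : nat) : set Omega :=
  [set w | forall m, (0 < m <= n)%N -> X m w <> W m w].

Definition faithful (X W : nat -> Omega -> T) : Prop :=
  forall w n, (0 < n)%N -> X n w = W n w -> forall m, (n <= m)%N -> X m w = W m w.

Definition estim (phi : T -> R) (X W : nat -> Omega -> T) (k : nat) (w : Omega) : R :=
  phi (X k w) + \sum_(k.+1 <= n < meet_time X W w) (phi (X n w) - phi (W n w)).
End estim.

Definition pX {Omega T : Type} (Y : nat -> Omega -> T * T) : nat -> Omega -> T :=
  fun n w => (Y n w).1.
Definition pW {Omega T : Type} (Y : nat -> Omega -> T * T) : nat -> Omega -> T :=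
  fun n w => (Y n w).2.
(** for Z_n = ((X_{n,l},W_{n,l}),(X_{n,l-1},W_{n,l-1})): the level-l pair
    (upper) and the level-(l-1) pair (lower) *)
Definition upper {Omega T : Type} (Z : nat -> Omega -> (T * T) * (T * T))
  : nat -> Omega -> T * T := fun n w => (Z n w).1.
Definition lower {Omega T : Type} (Z : nat -> Omega -> (T * T) * (T * T))
  : nat -> Omega -> T * T := fun n w => (Z n w).2.

Definition coord4 {T : Type} (z : (T * T) * (T * T)) (i : nat) : T :=
  nth z.1.1 [:: z.1.1; z.1.2; z.2.1; z.2.2] i.

Definition B_set {T : Type} (dm : T -> T -> R) (C beta2 : R) (l : nat)
  : set ((T * T) * (T * T)) :=
  [set z | forall i j, (i < 4)%N -> (j < 4)%N ->
           dm (coord4 z i) (coord4 z j) <= C * Delta_pow l beta2].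

Definition check_nu {d : measure_display} {T : measurableType d}
   (nut : probability (T * T)%type R) (K : R.-pker T ~> T) (C : set (T * T)) : \bar R :=
  (\int[nut]_z K z.1 (ysection C z.2))%E.

End defs.

(* Main.v *)
(* For the increment xi_l, run both pairs of chains up to the horizon N = l + k.
   Either all four coordinates stay within O(Delta_l^beta2) of each other and the
   pairs meet by time N, so that |xi_l| = O(N Delta_l^beta2); or the chain leaves
   B_l before N, which has probability O(N Delta_l^(beta2 (2 + eps))); or a meeting
   time exceeds N, which is exponentially unlikely while |xi_l| grows only linearly
   with the meeting time.  Hence E[xi_l^2] = O(r^l) for some r < 1 that does not
   depend on phi, and the geometric law with ratio q = sqrt r makes
   sum_l E[xi_l^2] / P_L(l) finite.  For the mean, the shift in the initial law
   makes W_(n+1) and X_n equidistributed, so truncated estimators telescope to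
   E[phi(X_N)], which tends to pi_s(phi); faithfulness and the exponential tails of
   the meeting times control the truncation.  Independence of L then turns E into
   the telescoping sum of pi_l(phi) - pi_(l-1)(phi). *)
Require Import Defs.
From HB Require Import structures.
From mathcomp Require Import all_boot all_order all_algebra.
From mathcomp Require Import all_classical all_reals all_analysis.
From mathcomp Require Import measurable_realfun ring lra.
Import Order.TTheory GRing.Theory Num.Theory.
Import numFieldNormedType.Exports.
Local Open Scope classical_set_scope.
Local Open Scope ring_scope.

(** * Integrals of bounded functions *)

(** Three features of the setting shape the argument. Mixing is a bound on probabilities of sets,
    whereas the estimators involve bounded functions; superlevel sets carry it over. The chains are
    known through their path probabilities on rectangles. This suffices for the mean, since by
    linearity a truncated estimator sees only the one-time laws of single coordinates, and each
    coordinate evolves by its own kernel. Finally, the number of summands is random, and [meet_time]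
    is 0 where the chains never meet; integrals are therefore bounded by dominating the integrand
    pointwise by sums of indicators of the events [meet_gt], whose probabilities are controlled
    directly. The horizon is linear in l: long enough for rho^N to be O(rho^l), short enough for the
    powers of N, which count summands and possible exit times, to be absorbed by a geometric rate at
    the price of a larger ratio. The law of L is fixed before phi, so the bound and the Lipschitz
    constant of phi may enter the constants but not that ratio. *)

Lemma measurable_fun_nat_select (d : measure_display) (Om : measurableType d)
    (R : realType) (N : Om -> nat) (g : nat -> Om -> R) :
  measurable_fun setT N -> (forall n, measurable_fun setT (g n)) ->
  measurable_fun setT (fun w => g (N w) w).
Proof.
move=> mN mg _ A mA; rewrite setTI.
have -> : (fun w => g (N w) w) @^-1` A =
    \bigcup_n ((N @^-1` [set n]) `&` (g n @^-1` A)).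
  apply/seteqP; split => w /=; first by move=> Aw; exists (N w).
  by move=> [n _ [/= <-]].
apply: bigcupT_measurable => n; apply: measurableI.
- by rewrite -(setTI (_ @^-1` _)); exact: mN.
- by rewrite -(setTI (_ @^-1` _)); exact: mg.
Qed.

Lemma bounded_fun_integrable (d : measure_display) (T : measurableType d)
    (R : realType) (P : probability T R) (f : T -> R) (M : R) :
  measurable_fun setT f -> (forall x, `|f x| <= M) ->
  P.-integrable setT (EFin \o f).
Proof.
move=> mf fM; apply: measurable_bounded_integrable => //.
  by rewrite ltey_eq fin_num_measure.
exists M; split; first exact: num_real.
by move=> x Mx y _ /=; exact: le_trans (fM y) (ltW Mx).
Qed.

Lemma Rintegral_cst_probability (d : measure_display) (T : measurableType d)
    (R : realType) (P : probability T R) (r : R) : \int[P]_x r = r.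
Proof.
have -> : \int[P]_x r = r * fine (P setT) by exact: Rintegral_cst.
by rewrite probability_setT mulr1.
Qed.

Lemma integrable_EFinB (d : measure_display) (T : measurableType d)
    (R : realType) (mu : {measure set T -> \bar R}) (f g : T -> R) :
  mu.-integrable setT (EFin \o f) -> mu.-integrable setT (EFin \o g) ->
  mu.-integrable setT (EFin \o (fun x => f x - g x)).
Proof. by move=> fi gi; exact: (integrableB measurableT fi gi). Qed.

Lemma Rintegral_sum (d : measure_display) (T : measurableType d)
    (R : realType) (mu : {measure set T -> \bar R}) (I : Type) (s : seq I)
    (f : I -> T -> R) :
  (forall i, mu.-integrable setT (EFin \o f i)) ->
  \int[mu]_x (\sum_(i <- s) f i x) = \sum_(i <- s) \int[mu]_x f i x.
Proof.
move=> fi; elim: s => [|i s IH].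
  by under eq_Rintegral do rewrite big_nil; rewrite big_nil Rintegral_cst// mul0r.
under eq_Rintegral do rewrite big_cons.
rewrite big_cons -IH RintegralD//.
have -> : EFin \o (fun x => \sum_(j <- s) f j x) =
    (fun x => (\sum_(j <- s) (EFin \o f j) x)%E).
  by apply/funext => x /=; rewrite sumEFin.
exact: integrable_sum.
Qed.

Lemma fine_probability (d : measure_display) (T : measurableType d)
    (R : realType) (P : probability T R) (A : set T) : measurable A ->
  \int[P]_x (\1_A x : R) = fine (P A).
Proof. by move=> mA; rewrite /Rintegral integral_indic// setIT. Qed.

(** The indicators of the events [j.+1 <= h] add up to the integer part of [h], which is within 1 of
    [h]. This is the bridge from probabilities of sets to integrals. *)
Lemma Rintegral_layers (d : measure_display) (T : measurableType d)
    (R : realType) (P : probability T R) (h : T -> R) (n : nat) :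
  measurable_fun setT h -> (forall x, 0 <= h x <= n%:R) ->
  `|\int[P]_x h x - \sum_(j < n) fine (P [set x | j.+1%:R <= h x])| <= 1.
Proof.
move=> mh hn.
have mA (j : nat) : measurable [set x | j%:R <= h x].
  have -> : [set x | j%:R <= h x] = h @^-1` `[j%:R, +oo[%classic.
    by apply/seteqP; split => x /=; rewrite in_itv/= andbT.
  by rewrite -(setTI (_ @^-1` _)); exact: mh.
have ih : P.-integrable setT (EFin \o h).
  apply: (@bounded_fun_integrable _ _ _ _ _ n%:R) => // x.
  by have /andP[h0 h1] := hn x; rewrite ger0_norm.
have i1 (j : 'I_n) :
    P.-integrable setT (EFin \o (\1_[set x | j.+1%:R <= h x] : T -> R)).
  apply: (@bounded_fun_integrable _ _ _ _ _ 1) => [|x].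
    exact: measurable_indic.
  by rewrite indicE ger0_norm// lern1 leq_b1.
under eq_bigr do rewrite -fine_probability//.
rewrite -Rintegral_sum//.
have layers x : \sum_(j < n) (\1_[set y | j.+1%:R <= h y] x : R) =
    (Num.truncn (h x))%:R.
  have /andP[h0 h1] := hn x.
  have tn : (Num.truncn (h x) <= n)%N.
    by rewrite -(ler_nat R) (le_trans _ h1)// truncn_le.
  have jt (j : nat) : (x \in [set y | j.+1%:R <= h y]) = (j < Num.truncn (h x))%N.
    by rewrite truncn_ge_nat//; apply/idP/idP; rewrite inE.
  under eq_bigr do rewrite indicE jt.
  rewrite -natr_sum; congr _%:R.
  transitivity (\sum_(j < n | (j < Num.truncn (h x))%N) 1)%N.
    by rewrite [RHS]big_mkcond; apply: eq_bigr => i _; case: ifP.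
  by rewrite (big_ord_narrow tn) sum1_card card_ord.
under [X in _ - X]eq_Rintegral do rewrite layers.
have mt : P.-integrable setT (EFin \o (fun x => (Num.truncn (h x))%:R : R)).
  apply: (@bounded_fun_integrable _ _ _ _ _ n%:R) => [|x]; last first.
    have /andP[h0 h1] := hn x.
    by rewrite ger0_norm// (le_trans _ h1)// truncn_le.
  under eq_fun do rewrite -layers.
  by apply: measurable_sum => j; exact: measurable_indic.
rewrite -RintegralB//.
apply: le_trans (le_normr_Rintegral _ _) _ => //.
  exact: integrable_EFinB.
rewrite -[leRHS](_ : \int[P]_x (cst (1 : R)) x = 1); last first.
  exact: Rintegral_cst_probability.
apply: le_Rintegral => //.
- exact/integrable_norm/integrable_EFinB.
- exact/finite_measure_integrable_cst.
- move=> x _; have /andP[h0 _] := hn x.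
  have /andP[t1 t2] := truncn_itv h0.
  rewrite ger0_norm ?subr_ge0//= lerBlDl; apply/ltW.
  by rewrite natr1.
Qed.

(** After a shift by [M] the function takes values between 0 and [2 * M]. Scaled by [m.+1] it has
    about [m.+1 * 2 * M] layers, and each layer is a set to which the two laws give masses at most
    [e] apart. *)
Lemma Rintegral_law_dist (d d1 d2 : measure_display) (T : measurableType d)
    (T1 : measurableType d1) (T2 : measurableType d2) (R : realType)
    (P1 : probability T1 R) (P2 : probability T2 R)
    (X1 : T1 -> T) (X2 : T2 -> T) (f : T -> R) (M e : R) :
  measurable_fun setT X1 -> measurable_fun setT X2 -> measurable_fun setT f ->
  (forall x, `|f x| <= M) ->
  (forall A, measurable A ->
    `|fine (P1 (X1 @^-1` A)) - fine (P2 (X2 @^-1` A))| <= e) ->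
  `|\int[P1]_x f (X1 x) - \int[P2]_x f (X2 x)| <= (2 * M + 1) * e.
Proof.
move=> mX1 mX2 mf fM XX.
have e0 : 0 <= e by apply: le_trans (XX setT measurableT).
have M0 : 0 <= M by apply: le_trans (fM (X1 point)).
pose g x := f x + M.
have g0 x : 0 <= g x by have := fM x; rewrite ler_norml /g; lra.
have gM x : g x <= 2 * M by have := fM x; rewrite ler_norml /g; lra.
have mg : measurable_fun setT g by exact: measurable_funD.
have gE (d' : measure_display) (T' : measurableType d') (P' : probability T' R)
    (X' : T' -> T) : measurable_fun setT X' ->
    \int[P']_x g (X' x) = \int[P']_x f (X' x) + M.
  move=> mX'; rewrite RintegralD//.
  - by rewrite Rintegral_cst_probability.
  - by apply: (@bounded_fun_integrable _ _ _ _ _ M) => //; exact: measurableT_comp.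
  - exact/finite_measure_integrable_cst.
(* The rounding errors of the two layer sums total 2 whatever [m] is, so they disappear after
   division by [m.+1]. The summand 1 next to [m.+1%:R * (2 * M)] comes from rounding up the number
   of layers; bounding it by [m.+1] yields the factor [2 * M + 1]. *)
suff key m : m.+1%:R * `|\int[P1]_x f (X1 x) - \int[P2]_x f (X2 x)| <=
    2 + (m.+1%:R * (2 * M) + 1) * e.
  rewrite leNgt; apply/negP => lt.
  set D := `|_| in key lt.
  pose a := D - (2 * M + 1) * e.
  have a0 : 0 < a by rewrite /a; lra.
  have := key (Num.truncn (2 / a)).
  have := truncnS_gt (2 / a); set m := (Num.truncn _).+1%:R => am.
  have m1 : 1 <= m by rewrite /m ler1n.
  have : 2 < m * a by rewrite -ltr_pdivrMr.
  rewrite /a => h1 h2.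
  have : e <= m * e by rewrite ler_peMl.
  nra.
pose n := (Num.truncn (m.+1%:R * (2 * M))).+1.
have nM : n%:R <= m.+1%:R * (2 * M) + 1.
  by rewrite -[leLHS]natr1 lerD2r truncn_le mulr_ge0// mulr_ge0.
have nM' : m.+1%:R * (2 * M) <= n%:R.
  exact/ltW/truncnS_gt.
have hb x : 0 <= m.+1%:R * g x <= n%:R.
  rewrite mulr_ge0//=; apply: le_trans nM'; exact: ler_wpM2l.
have mh (d' : measure_display) (T' : measurableType d') (X' : T' -> T) :
    measurable_fun setT X' -> measurable_fun setT (fun x => m.+1%:R * g (X' x)).
  by move=> mX'; apply: measurable_funM => //; exact: measurableT_comp.
have L1 := Rintegral_layers _ _ _ P1 _ _ (mh _ _ _ mX1) (fun x => hb (X1 x)).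
have L2 := Rintegral_layers _ _ _ P2 _ _ (mh _ _ _ mX2) (fun x => hb (X2 x)).
have ig (d' : measure_display) (T' : measurableType d') (P' : probability T' R)
    (X' : T' -> T) : measurable_fun setT X' ->
    P'.-integrable setT (EFin \o (fun x => g (X' x))).
  move=> mX'; apply: (@bounded_fun_integrable _ _ _ _ _ (2 * M)).
    exact: measurableT_comp.
  by move=> x; rewrite ger0_norm.
rewrite RintegralZl// ?gE// in L1; last exact: ig.
rewrite RintegralZl// ?gE// in L2; last exact: ig.
have SS : `|\sum_(j < n) fine (P1 [set x | j.+1%:R <= m.+1%:R * g (X1 x)]) -
    \sum_(j < n) fine (P2 [set x | j.+1%:R <= m.+1%:R * g (X2 x)])| <= n%:R * e.
  rewrite -sumrB; apply: le_trans (ler_norm_sum _ _ _) _.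
  apply: (@le_trans _ _ (\sum_(j < n) e)); last first.
    by rewrite sumr_const card_ord mulr_natl.
  apply: ler_sum => j _.
  apply: (XX [set y | j.+1%:R <= m.+1%:R * g y]).
  rewrite (_ : [set y | _] = (fun y => m.+1%:R * g y) @^-1` `[j.+1%:R, +oo[%classic).
    by rewrite -(setTI (_ @^-1` _)); apply: measurable_funM.
  by apply/seteqP; split => x /=; rewrite in_itv/= andbT.
have : n%:R * e <= (m.+1%:R * (2 * M) + 1) * e by exact: ler_wpM2r.
have -> x : m.+1%:R * `|x| = `|m.+1%:R * x| by rewrite normrM ger0_norm.
move: L1 L2 SS.
set a := \int[P1]_x _; set b := \int[P2]_x _; set s := \sum_(j < n) _.
set s' := \sum_(j < n) _; set mm := m.+1%:R; set ne := n%:R * e; set me := _ * e.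
rewrite !ler_norml => /andP[? ?] /andP[? ?] /andP[? ?] ?.
by apply/andP; split; lra.
Qed.

(** * Laws of projected Markov chains *)

(** Arbitrary measures are allowed because the lemma compares not only laws of random variables but
    also the kernels [Kc z] and [K (p z)], and a restriction of [P] with a multiple of [P]. *)
Lemma integral_eq_law (d d1 d2 : measure_display) (T : measurableType d)
    (T1 : measurableType d1) (T2 : measurableType d2) (R : realType)
    (m1 : {measure set T1 -> \bar R}) (m2 : {measure set T2 -> \bar R})
    (X1 : T1 -> T) (X2 : T2 -> T) (f : T -> \bar R) :
  measurable_fun setT X1 -> measurable_fun setT X2 -> measurable_fun setT f ->
  (forall x, (0 <= f x)%E) ->
  (forall A, measurable A -> m1 (X1 @^-1` A) = m2 (X2 @^-1` A)) ->
  (\int[m1]_x f (X1 x) = \int[m2]_x f (X2 x))%E.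
Proof.
move=> mX1 mX2 mf f0 XX.
have H1 := ge0_integral_pushforward mX1 m1 measurableT mf (fun x _ => f0 x).
have H2 := ge0_integral_pushforward mX2 m2 measurableT mf (fun x _ => f0 x).
rewrite !preimage_setT in H1 H2.
rewrite -[LHS]H1 -[RHS]H2; apply: eq_measure_integral => A mA _.
exact: XX.
Qed.

Lemma integral_kernel_mixture (d dO : measure_display) (T : measurableType d)
    (Omega : measurableType dO) (R : realType) (P : probability Omega R)
    (nu : probability T R) (K : R.-pker T ~> T) (X : Omega -> T)
    (f : T -> \bar R) :
  measurable_fun setT X -> measurable_fun setT f -> (forall x, (0 <= f x)%E) ->
  (forall A, measurable A -> P (X @^-1` A) = \int[nu]_x K x A)%E ->
  (\int[P]_w f (X w) = \int[nu]_x \int[K x]_y f y)%E.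
Proof.
move=> mX mf f0 HX.
(* As a constant kernel on [unit], [nu] can be composed with [K]; the hypothesis on [X] says that
   its law is this composite. *)
pose l := @kprobability _ _ unit T R (fun=> nu) (measurable_cst _).
have := @integral_kcomp _ _ _ unit T T R l (kernel.kernel_snd K) tt f f0 mf.
rewrite /l /kprobability /= => <-.
have H1 := ge0_integral_pushforward mX P measurableT mf (fun x _ => f0 x).
rewrite preimage_setT in H1; rewrite -[LHS]H1.
apply: eq_measure_integral => A mA _; exact: HX.
Qed.

Lemma kiter_ge0 (d : measure_display) (T : measurableType d) (R : realType)
    (K : R.-pker T ~> T) n x A : (0 <= kiter K n x A)%E.
Proof.
by elim: n x => [|n IH] x /=; [rewrite lee_fin | apply: integral_ge0].
Qed.

Lemma measurable_kiter (d : measure_display) (T : measurableType d)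
    (R : realType) (K : R.-pker T ~> T) n A :
  measurable A -> measurable_fun setT (fun x => kiter K n x A).
Proof.
move=> mA; elim: n => [|n IH] /=.
  exact/measurable_EFinP/measurable_indic.
apply: measurable_fun_integral_kernel => //.
- exact: measurable_kernel.
- by move=> z; exact: kiter_ge0.
Qed.

Section projected_chain.
Context (R : realType) (d dS dO : measure_display) (T : measurableType d)
  (S : measurableType dS) (Omega : measurableType dO)
  (P : probability Omega R) (K : R.-pker T ~> T) (Kc : R.-pker S ~> S)
  (p : S -> T) (Z : nat -> Omega -> S).
Hypothesis mp : measurable_fun setT p.
Hypothesis Kcp : forall z A, measurable A -> Kc z (p @^-1` A) = K (p z) A.

Let mpA A : measurable A -> measurable (p @^-1` A).
Proof. by move=> mA; rewrite -(setTI (_ @^-1` _)); exact: mp. Qed.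

(** By [Kcp] the image of [Kc z] under [p] depends on [z] only through [p z], so every one-step
    integral of a function of the projection is an integral against [K]. The earlier constraints
    [setT] contribute factors 1. *)
Lemma fdd_projection n z A : measurable A ->
  fdd Kc (rcons (nseq n setT) (p @^-1` A)) z = kiter K n.+1 (p z) A.
Proof.
move=> mA; elim: n z => [|n IH] z.
  rewrite /=; under eq_integral do rewrite mule1.
  rewrite [LHS]integral_indic//; last exact: mpA.
  by rewrite [RHS]integral_indic// !setIT Kcp.
rewrite [LHS]/= [RHS]/=.
under eq_integral do rewrite indicT mul1e IH.
apply: (integral_eq_law _ _ _ _ _ _ _ _ _ p id (fun x => kiter K n.+1 x A)) => //.
- exact: measurable_kiter.
- by move=> x; exact: kiter_ge0.
- by move=> B mB; rewrite Kcp.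
Qed.

Hypothesis HZ : markov_chain P Z Kc.

Lemma law_projection n A : measurable A ->
  P ((fun w => p (Z n w)) @^-1` A) = (\int[P]_w kiter K n (p (Z 0%N w)) A)%E.
Proof.
move=> mA; have [mZ HP] := HZ.
case: n => [|n].
  transitivity (\int[P]_w (\1_((fun w => p (Z 0%N w)) @^-1` A) w)%:E)%E.
    rewrite integral_indic ?setIT// -(setTI (_ @^-1` _)).
    exact: (measurableT_comp mp (mZ 0%N)).
  by apply: eq_integral => w _ /=; rewrite !indicE; congr (_%:R%:E).
(* An event at time [n.+1] is a path rectangle with trivial sides at time 0 and at the first [n]
   steps. Time 0 is treated apart because the list of sides starts at time 1. *)
have := HP setT (rcons (nseq n setT) (p @^-1` A)) measurableT.
rewrite size_rcons size_nseq => H.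
transitivity (P [set w | [set: S] (Z 0%N w) /\ forall i, (i < n.+1)%N ->
    nth setT (rcons (nseq n setT) (p @^-1` A)) i (Z i.+1 w)]).
  congr (P _); apply/seteqP; split => w /=.
    move=> Aw; split => // i; rewrite ltnS nth_rcons size_nseq nth_nseq.
    by rewrite leq_eqVlt => /predU1P[->|->]//; rewrite ltnn eqxx.
  move=> [_ /(_ n (ltnSn n))].
  by rewrite nth_rcons size_nseq ltnn eqxx.
rewrite H; last first.
  move=> i; rewrite ltnS nth_rcons size_nseq nth_nseq.
  rewrite leq_eqVlt => /predU1P[->|->]//.
  by rewrite ltnn eqxx; exact: mpA.
by apply: eq_integral => w _; rewrite indicT mul1e fdd_projection.
Qed.

End projected_chain.

Section check_nu_marginals.
Context (R : realType) (d : measure_display) (T : measurableType d)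
  (nu : probability T R) (nut : probability (T * T)%type R)
  (K : R.-pker T ~> T).
Hypothesis Hnut : forall A : set T, measurable A ->
  nut (A `*` setT) = nu A /\ nut (setT `*` A) = nu A.

Lemma check_nu_fst A : measurable A ->
  check_nu nut K (A `*` setT) = (\int[nu]_x K x A)%E.
Proof.
move=> mA; rewrite /check_nu.
transitivity (\int[nut]_z K z.1 A)%E.
  apply: eq_integral => z _; congr (K _ _).
  by apply/seteqP; split => x /=; rewrite /ysection/= inE/=; [case|].
apply: (integral_eq_law _ _ _ _ _ _ _ _ _ fst id (fun x => K x A)) => //.
- exact: measurable_kernel.
- move=> B mB; rewrite -[RHS](Hnut _ mB).1; congr (nut _).
  by apply/seteqP; split => -[x y] //= [].
Qed.

(** The kernel moves the first coordinate only, so the section inside [check_nu] is the whole space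
    or empty according to the second coordinate, and receives mass 1 or 0. *)
Lemma check_nu_snd A : measurable A ->
  check_nu nut K (setT `*` A) = nu A.
Proof.
move=> mA; rewrite /check_nu.
transitivity (\int[nut]_z (\1_(setT `*` A) z)%:E)%E; last first.
  rewrite integral_indic; [|exact: measurableT|by apply: measurableX].
  by rewrite setIT; exact: (Hnut _ mA).2.
apply: eq_integral => -[x y] _ /=; rewrite indicE.
have [yA|yA] := boolP (y \in A).
- rewrite (_ : ysection _ _ = setT); last first.
    by apply/seteqP; split => z //= _; rewrite /ysection/= inE/=; rewrite inE in yA.
  rewrite prob_kernel mem_set//=; by rewrite inE in yA.
- rewrite (_ : ysection _ _ = set0); last first.
    apply/seteqP; split => z //=; rewrite /ysection/= inE/= => -[_ ?].
    by rewrite notin_setE in yA.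
  rewrite measure0 memNset//= => -[_ ?].
  by rewrite notin_setE in yA.
Qed.

End check_nu_marginals.

(** * Tail bounds for integrals *)

Lemma sum_geometric_le (R : realType) (a r : R) (N m : nat) :
  0 <= a -> 0 < r < 1 ->
  \sum_(N <= n < m) a * r ^+ n <= a * r ^+ N / (1 - r).
Proof.
move=> a0 /andP[r0 r1].
have r1' : 0 < 1 - r by rewrite subr_gt0.
have [Nm|mN] := leqP N m; last first.
  by rewrite big_geq ?(ltnW mN)// divr_ge0 ?mulr_ge0 ?exprn_ge0//; exact: ltW.
rewrite -(subnKC Nm); move: (m - N)%N => j.
suff E i : \sum_(N <= n < N + i) a * r ^+ n = a * (r ^+ N - r ^+ (N + i)) / (1 - r).
  rewrite E ler_pM2r ?invr_gt0// ler_wpM2l// gerBl exprn_ge0//; exact: ltW.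
elim: i => [|i IHi]; first by rewrite addn0 big_geq// subrr mulr0 mul0r.
rewrite addnS big_nat_recr ?leq_addr//= IHi exprS.
by field; rewrite lt0r_neq0.
Qed.

Lemma eseries_geometric_le (R : realType) (a r : R) (N : nat) (u : nat -> \bar R) :
  0 <= a -> 0 < r < 1 ->
  (forall n, (0 <= u n)%E) -> (forall n, (N <= n)%N -> (u n <= (a * r ^+ n)%:E)%E) ->
  (\sum_(N <= n <oo) u n <= (a * r ^+ N / (1 - r))%:E)%E.
Proof.
move=> a0 r01 u0 ua; apply: lime_le.
  by apply: is_cvg_nneseries => n _ _; exact: u0.
near=> m.
apply: (@le_trans _ _ (\sum_(N <= n < m) a * r ^+ n)%:E); last first.
  by rewrite lee_fin sum_geometric_le.
by rewrite -sumEFin !big_nat; apply: lee_sum => n /andP[Nn _]; exact: ua.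
Unshelve. all: by end_near.
Qed.

(** Here [D] stands for the distance between a mean and its target, which does not involve the
    horizon [N], so the bound may be taken to its limit. *)
Lemma le0_geometric (R : realType) (D a r : R) (k : nat) : 0 < r < 1 ->
  (forall N, (k <= N)%N -> D <= a * r ^+ N) -> D <= 0.
Proof.
move=> /andP[r0 r1] H.
have c : (fun n => a * r ^+ n) @ \oo --> 0.
  by apply: cvg_geometric; rewrite ger0_norm// ltW.
rewrite -(cvg_lim _ c)//; apply: limr_ge; first by apply/cvg_ex; exists 0.
by exists k => // n /= kn; exact: H.
Qed.

(** The cutoff [m] may depend on [x], so it can be a meeting time. Each finite sum lies below the
    full series of nonnegative terms, and that series is integrated term by term. *)
Lemma le_integral_tail (R : realType) (d : measure_display)
    (T : measurableType d) (P : {measure set T -> \bar R}) (f g : T -> R)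
    (c : nat -> R) (A : nat -> set T) (N : nat) :
  measurable_fun setT f -> measurable_fun setT g ->
  (forall n, measurable (A n)) ->
  (forall x, 0 <= f x) -> (forall x, 0 <= g x) -> (forall n, 0 <= c n) ->
  (forall x, exists m, f x <= g x + \sum_(N <= n < m) c n * \1_(A n) x) ->
  (\int[P]_x (f x)%:E <=
     \int[P]_x (g x)%:E + \sum_(N <= n <oo) ((c n)%:E * P (A n)))%E.
Proof.
move=> mf mg mA f0 g0 c0 H.
pose u n x := if (N <= n)%N then (c n * \1_(A n) x)%:E else 0%E.
have mu n : measurable_fun setT (u n).
  rewrite /u; case: leqP => _ //.
  by apply/measurable_EFinP/measurable_funM => //; exact: measurable_indic.
have u0 n x : (0 <= u n x)%E.
  by rewrite /u; case: leqP => _ //; rewrite lee_fin mulr_ge0.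
have seriesE (v : nat -> \bar R) : (\sum_(N <= n <oo) v n =
    \sum_(0 <= n <oo) (if (N <= n)%N then v n else 0))%E.
  by rewrite eseries_cond eseries_mkcond.
have -> : (\sum_(N <= n <oo) ((c n)%:E * P (A n)) =
           \int[P]_x \sum_(0 <= n <oo) u n x)%E.
  rewrite integral_nneseries// seriesE; apply: eq_eseriesr => n _.
  rewrite /u; case: leqP => _; last by rewrite integral0.
  under eq_integral do rewrite EFinM.
  rewrite ge0_integralZl//.
  - by rewrite integral_indic// setIT.
  - by apply/measurable_EFinP; exact: measurable_indic.
  - by rewrite lee_fin.
have ms : measurable_fun setT (fun x => \sum_(0 <= n <oo) u n x)%E.
  exact: ge0_emeasurable_sum.
have -> : (\int[P]_x (g x)%:E + \int[P]_x \sum_(0 <= n <oo) u n x =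
    \int[P]_x ((g x)%:E + \sum_(0 <= n <oo) u n x))%E.
  rewrite ge0_integralD//.
  - by move=> x _; rewrite lee_fin.
  - exact/measurable_EFinP.
  - by move=> x _; exact: nneseries_ge0.
apply: ge0_le_integral => //.
- by move=> x _; rewrite lee_fin.
- exact/measurable_EFinP.
- by apply: emeasurable_funD; [exact/measurable_EFinP|].
move=> x _; have [m Hm] := H x.
apply: (@le_trans _ _ (g x + \sum_(N <= n < m) c n * \1_(A n) x)%:E).
  by rewrite lee_fin.
rewrite EFinD leeD2l// -sumEFin.
have := seriesE (fun n => (c n * \1_(A n) x)%:E); rewrite -/(u^~ x) => <-.
by apply: nneseries_lim_ge => n _; rewrite lee_fin mulr_ge0.
Qed.

(** * Meeting times *)

Section meeting_time.
Context (Omega T : Type) (X W : nat -> Omega -> T).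

(** Members of the defining set are positive, so the default 0 of [xget] is taken exactly when the
    set is empty; a first coincidence would be a member, hence by induction there is none at any
    time. *)
Lemma meet_timeP w :
  (meet_time X W w = 0%N /\ forall n, meet_gt X W n w) \/
  [/\ (0 < meet_time X W w)%N,
      X (meet_time X W w) w = W (meet_time X W w) w &
      forall m, (0 < m < meet_time X W w)%N -> X m w <> W m w].
Proof.
rewrite /meet_time; set S := [set n | _].
have [[n Sn]|S0] := pselect (S !=set0).
  by right; have [? [? ?]] : S (xget 0%N S) := xgetPex 0%N (ex_intro _ n Sn).
left; split.
  by apply: xgetPN => n Sn; apply: S0; exists n.
move=> n; elim: n => [m|n IH]; first by case: m.
move=> m /andP[m0]; rewrite leq_eqVlt => /predU1P[->|mn]; last first.
  by apply: IH; rewrite m0 -ltnS.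
move=> XW; apply: S0; by exists n.+1.
Qed.

(** Only this direction holds: if the chains never meet, [meet_gt] is true at every [n] while
    [meet_time] is 0. *)
Lemma meet_gt_lt_meet_time n w : (n < meet_time X W w)%N -> meet_gt X W n w.
Proof.
have [[-> //]|[t0 XWt H]] := meet_timeP w.
by move=> nt m /andP[m0 mn]; apply: H; rewrite m0 (leq_ltn_trans mn).
Qed.

Lemma preimage_meet_timeS n :
  meet_time X W @^-1` [set n.+1] = meet_gt X W n `&` [set w | X n.+1 w = W n.+1 w].
Proof.
apply/seteqP; split => w /=.
  move=> tn; split; first by apply: meet_gt_lt_meet_time; rewrite tn.
  by have [[]|[_]] := meet_timeP w; rewrite tn.
move=> [gtn XWn].
have [[_ /(_ n.+1 n.+1)]|[t0 XWt H]] := meet_timeP w.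
  by rewrite leqnn => /(_ isT).
have [tn|nt|//] := ltngtP (meet_time X W w) n.+1.
- by exfalso; apply: (gtn (meet_time X W w)) => //; rewrite t0.
- by exfalso; apply: (H n.+1).
Qed.

End meeting_time.

Lemma measurable_fun_nat (d : measure_display) (Om : measurableType d)
    (N : Om -> nat) :
  (forall n, measurable (N @^-1` [set n])) -> measurable_fun setT N.
Proof.
move=> H _ A _; rewrite setTI.
rewrite (_ : N @^-1` A = \bigcup_(n in A) (N @^-1` [set n])).
  exact: bigcup_measurable.
by apply/seteqP; split => w /=; [move=> AN; exists (N w)|move=> [n An /= ->]].
Qed.

(** A sigma-algebra need not make the diagonal measurable; here the diagonal is the zero set of the
    measurable function [dm]. *)
Lemma measurable_coincidence (R : realType) (d dO : measure_display)
    (T : measurableType d) (Omega : measurableType dO) (dm : T -> T -> R)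
    (X W : Omega -> T) :
  is_metric dm -> measurable_fun setT (fun z : T * T => dm z.1 z.2) ->
  measurable_fun setT X -> measurable_fun setT W ->
  measurable [set w | X w = W w].
Proof.
move=> [_ dm0 _ _] mdm mX mW.
have -> : [set w | X w = W w] = (fun w => dm (X w) (W w)) @^-1` [set 0].
  by apply/seteqP; split => w /= /dm0.
rewrite -(setTI (_ @^-1` _)).
have mXW : measurable_fun setT (fun w => (X w, W w)) by exact/measurable_fun_pair.
exact: (measurableT_comp mdm mXW).
Qed.

Section estimator_measurability.
Context (R : realType) (d dO : measure_display) (T : measurableType d)
  (Omega : measurableType dO) (X W : nat -> Omega -> T).
Hypothesis mX : forall n, measurable_fun setT (X n).
Hypothesis mW : forall n, measurable_fun setT (W n).
Hypothesis mXW : forall n, measurable [set w | X n w = W n w].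

Lemma measurable_meet_gt n : measurable (meet_gt X W n).
Proof.
have -> : meet_gt X W n =
    \bigcap_(m in [set m | (0 < m <= n)%N]) ~` [set w | X m w = W m w].
  by apply/seteqP; split => w H m; exact: H.
by apply: bigcap_measurableType => m _; exact: measurableC.
Qed.

Lemma measurable_meet_time : measurable_fun setT (meet_time X W).
Proof.
have mS n : measurable (meet_time X W @^-1` [set n.+1]).
  rewrite preimage_meet_timeS; apply: measurableI => //.
  exact: measurable_meet_gt.
apply: measurable_fun_nat => -[|n //].
have -> : meet_time X W @^-1` [set 0%N] =
    ~` \bigcup_n (meet_time X W @^-1` [set n.+1]).
  apply/seteqP; split => w /=; first by move=> t0 [n _ /=]; rewrite t0.
  move=> H; case E : (meet_time X W w) => [//|n].
  by exfalso; apply: H; exists n.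
by apply: measurableC; exact: bigcupT_measurable.
Qed.

Lemma measurable_partial_estim (phi : T -> R) (k t : nat) :
  measurable_fun setT phi ->
  measurable_fun setT
    (fun w => phi (X k w) + \sum_(k.+1 <= n < t) (phi (X n w) - phi (W n w))).
Proof.
move=> mphi; apply: measurable_funD; first exact: measurableT_comp.
apply: measurable_sum => n.
by apply: measurable_funB; exact: measurableT_comp.
Qed.

Lemma measurable_estim (phi : T -> R) (k : nat) :
  measurable_fun setT phi -> measurable_fun setT (estim phi X W k).
Proof.
move=> mphi.
apply: (measurable_fun_nat_select _ _ _ (meet_time X W)
  (fun t w => phi (X k w) + \sum_(k.+1 <= n < t) (phi (X n w) - phi (W n w)))).
- exact: measurable_meet_time.
- by move=> t; exact: measurable_partial_estim.
Qed.

End estimator_measurability.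

Lemma sum_norm_le (R : realType) (a : nat -> R) (D : R) (i j : nat) :
  (forall n, (i <= n < j)%N -> `|a n| <= D) ->
  `|\sum_(i <= n < j) a n| <= D *+ (j - i).
Proof.
move=> H; apply: le_trans (ler_norm_sum _ _ _) _.
apply: (@le_trans _ _ (\sum_(i <= n < j) D)); last by rewrite sumr_const_nat.
by rewrite !big_nat; exact: ler_sum.
Qed.

Lemma estim_norm_le (R : realType) (Omega T : Type) (X W : nat -> Omega -> T)
    (phi : T -> R) (M : R) (k : nat) (w : Omega) :
  (forall x, `|phi x| <= M) ->
  `|estim phi X W k w| <= M * (1 + 2 * (meet_time X W w)%:R).
Proof.
move=> phiM.
have M0 : 0 <= M by apply: le_trans (phiM (X 0%N w)).
have := @sum_norm_le R (fun n => phi (X n w) - phi (W n w)) (2 * M) k.+1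
  (meet_time X W w).
have h n : `|phi (X n w) - phi (W n w)| <= 2 * M.
  rewrite mulr_natl mulr2n; apply: le_trans (ler_normB _ _) _.
  by apply: lerD.
move=> /(_ (fun n _ => h n)) hs.
apply: le_trans (ler_normD _ _) _; rewrite mulrDr mulr1; apply: lerD => //.
apply: le_trans hs _; rewrite -[leLHS]mulr_natr (mulrC 2) -mulrA.
rewrite ler_wpM2l// ler_wpM2l// ler_nat; exact: leq_subr.
Qed.


(** * Square integrability and polynomial weights against geometric decay *)

Lemma sq_integrable_integrable (R : realType) (d : measure_display)
    (T : measurableType d) (P : probability T R) (f : T -> R) :
  measurable_fun setT f -> (\int[P]_x (f x ^+ 2)%:E < +oo)%E ->
  P.-integrable setT (EFin \o f).
Proof.
move=> mf f2.
have mf2 : measurable_fun setT (fun x => f x ^+ 2) by exact: measurable_funX.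
apply: (@le_integrable _ _ _ P setT measurableT _
    (EFin \o (fun x => 1 + f x ^+ 2))).
- exact/measurable_EFinP.
- move=> x _ /=; rewrite lee_fin [leRHS]ger0_norm ?addr_ge0 ?sqr_ge0//.
  have := sqr_ge0 (`|f x| - 1); rewrite -[f x ^+ 2]real_normK ?num_real//.
  have := normr_ge0 (f x); nra.
- have i1 : P.-integrable setT (EFin \o cst (1 : R)).
    exact/finite_measure_integrable_cst.
  have i2 : P.-integrable setT (EFin \o (fun x => f x ^+ 2)).
    apply/integrableP; split; first exact/measurable_EFinP.
    by under eq_integral do rewrite gee0_abs ?lee_fin ?sqr_ge0//.
  exact: (integrableD measurableT i1 i2).
Qed.

(** The factor [3 + 2 * n%:R] is [1 + 2 * t] at the meeting time [t = n + 1]. Half of the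
    exponential rate pays for it: [rho ^+ n] is [(u ^+ n) ^+ 2 * t ^+ n], with [t] and [u] the
    square and fourth roots of [rho], and Bernoulli's inequality for [u^-1 = 1 + h] keeps
    [(3 + 2 * n%:R) * u ^+ n] below [3 + 2 / h]. *)
Lemma square_geometric_le (R : realType) (rho : R) : 0 < rho < 1 ->
  exists r C : R, [/\ 0 < r < 1, 0 <= C &
    forall n : nat, (3 + 2 * n%:R) ^+ 2 * rho ^+ n <= C * r ^+ n].
Proof.
move=> /andP[p0 p1].
pose t := Num.sqrt rho; pose u := Num.sqrt t.
have t2 : t ^+ 2 = rho by rewrite sqr_sqrtr// ltW.
have t0 : 0 < t by rewrite sqrtr_gt0.
have t1 : t < 1 by rewrite -sqrtr1 ltr_sqrt.
have u2 : u ^+ 2 = t by rewrite sqr_sqrtr// ltW.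
have u0 : 0 < u by rewrite sqrtr_gt0.
have u1 : u < 1 by rewrite -sqrtr1 ltr_sqrt.
pose h := u^-1 - 1.
have h0 : 0 < h by rewrite subr_gt0 invf_gt1.
exists t, ((3 + 2 / h) ^+ 2); split; [by rewrite t0|exact: sqr_ge0|move=> n].
have bern : 1 + n%:R * h <= (1 + h) ^+ n.
  elim: n => [|n IH]; first by rewrite mul0r addr0 expr0.
  have := ler_wpM2r (ltW (addr_gt0 ltr01 h0)) IH; rewrite -exprSr -natr1.
  by apply: le_trans; have : 0 <= n%:R :> R by []; nra.
have key : (3 + 2 * n%:R) * u ^+ n <= 3 + 2 / h.
  have -> : u ^+ n = ((1 + h) ^+ n)^-1 by rewrite /h addrC subrK exprVn invrK.
  rewrite ler_pdivrMr; last by rewrite exprn_gt0// addr_gt0.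
  apply: (@le_trans _ _ ((3 + 2 / h) * (1 + n%:R * h))); last first.
    by rewrite ler_wpM2l// addr_ge0// divr_ge0// ltW.
  have -> : (3 + 2 / h) * (1 + n%:R * h) = 3 + 2 * n%:R + (3 * n%:R * h + 2 / h).
    by field; rewrite lt0r_neq0.
  rewrite lerDl addr_ge0//; first by rewrite !mulr_ge0// ltW.
  by rewrite divr_ge0// ltW.
have -> : rho ^+ n = (u ^+ n) ^+ 2 * t ^+ n.
  by rewrite -exprM mulnC exprM u2 -expr2 -exprM mulnC exprM t2.
rewrite mulrA -exprMn ler_wpM2r//; first by rewrite exprn_ge0// ltW.
rewrite ler_sqr// nnegrE.
- by rewrite mulr_ge0 ?exprn_ge0 ?addr_ge0// ltW.
- by rewrite addr_ge0// divr_ge0// ltW.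
Qed.

(** * A single unbiased estimator *)

Lemma square_tail_series_le (R : realType) (c C rho r C' : R) (N : nat)
    (p : nat -> \bar R) :
  0 < r < 1 -> 0 <= C -> 0 <= C' ->
  (forall n : nat, (3 + 2 * n%:R) ^+ 2 * rho ^+ n <= C' * r ^+ n) ->
  (forall n, (0 <= p n)%E) -> (forall n, (p n <= (C * rho ^+ n)%:E)%E) ->
  (\sum_(N <= n <oo) (((c * (3 + 2 * n%:R)) ^+ 2)%:E * p n) <=
     (c ^+ 2 * C * C' * r ^+ N / (1 - r))%:E)%E.
Proof.
move=> r01 C0 C'0 H p0 pC; apply: eseries_geometric_le => //.
- by rewrite mulr_ge0// mulr_ge0// sqr_ge0.
- by move=> n; rewrite mule_ge0// lee_fin sqr_ge0.
move=> n _.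
apply: (@le_trans _ _ (((c * (3 + 2 * n%:R)) ^+ 2)%:E * (C * rho ^+ n)%:E)%E).
  by apply: lee_wpmul2l => //; rewrite lee_fin sqr_ge0.
rewrite -EFinM lee_fin exprMn.
have := ler_wpM2l (mulr_ge0 (sqr_ge0 c) C0) (H n).
by congr (_ <= _); ring.
Qed.

Lemma integral_cst_probability (d : measure_display) (T : measurableType d)
    (R : realType) (P : probability T R) (r : R) :
  (\int[P]_x r%:E = r%:E)%E.
Proof.
have -> : (\int[P]_x r%:E = r%:E * P setT)%E by exact: integral_cst.
by rewrite probability_setT mule1.
Qed.

Section single_estimator.
Context (R : realType) (d dO : measure_display) (T : measurableType d)
  (Omega : measurableType dO) (P : probability Omega R)
  (X W : nat -> Omega -> T) (C rho : R).
Hypothesis mX : forall n, measurable_fun setT (X n).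
Hypothesis mW : forall n, measurable_fun setT (W n).
Hypothesis mXW : forall n, measurable [set w | X n w = W n w].
Hypothesis C0 : 0 <= C.
Hypothesis rho01 : 0 < rho < 1.
Hypothesis tail : forall n, (P (meet_gt X W n) <= (C * rho ^+ n)%:E)%E.

Lemma estim_sq_integral_lty (phi : T -> R) (k : nat) :
  measurable_fun setT phi -> is_bounded_fun phi ->
  (\int[P]_w (estim phi X W k w ^+ 2)%:E < +oo)%E.
Proof.
move=> mphi [M phiM].
have M0 : 0 <= M by apply: le_trans (phiM point).
have mest := measurable_estim _ _ _ _ _ X W mX mW mXW phi k mphi.
have [r [C' [r01 C'0 HC']]] := square_geometric_le _ _ rho01.
have H := le_integral_tail R _ _ P (fun w => estim phi X W k w ^+ 2)
  (cst (M ^+ 2)) (fun n => (M * (3 + 2 * n%:R)) ^+ 2) (meet_gt X W) 0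
  (measurable_funX 2 mest) (measurable_cst _)
  (measurable_meet_gt _ _ _ _ _ _ mXW)
  (fun=> sqr_ge0 _) (fun=> sqr_ge0 _) (fun=> sqr_ge0 _).
apply: le_lt_trans (H _) _.
  move=> w; exists (meet_time X W w).
  have B := estim_norm_le _ _ _ X W _ _ k w phiM.
  have {}B : estim phi X W k w ^+ 2 <= (M * (1 + 2 * (meet_time X W w)%:R)) ^+ 2.
    by rewrite -real_normK ?num_real// ler_sqr ?nnegrE// (le_trans _ B).
  apply: le_trans B _.
  (* At value 0 the correction sum is empty and the constant [M ^+ 2] suffices. At value [t.+1] the
     path lies in [meet_gt] at [t], and the last term of the sum alone dominates. *)
  case E : (meet_time X W w) => [|t].
    by rewrite mulr0 addr0 mulr1 big_geq// addr0.
  rewrite big_nat_recr//= addrA ler_wpDl//.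
    by rewrite addr_ge0 ?sqr_ge0// sumr_ge0// => n _; rewrite mulr_ge0 ?sqr_ge0.
  rewrite indicE mem_set ?mulr1; last by apply: meet_gt_lt_meet_time; rewrite E.
  by have -> : 1 + 2 * t.+1%:R = 3 + 2 * t%:R :> R by rewrite -natr1; ring.
rewrite integral_cst_probability lte_add_pinfty ?ltry//.
apply: le_lt_trans (square_tail_series_le _ M C rho r C' 0 _ r01 C0 C'0 HC' _ _) _.
- by move=> n; exact: measure_ge0.
- exact: tail.
- exact: ltry.
Qed.

Lemma estim_integrable (phi : T -> R) (k : nat) :
  measurable_fun setT phi -> is_bounded_fun phi ->
  P.-integrable setT (EFin \o estim phi X W k).
Proof.
move=> mphi bphi; apply: sq_integrable_integrable.
  exact: measurable_estim.
exact: estim_sq_integral_lty.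
Qed.

Hypothesis XW_faithful : faithful X W.

Let partial (phi : T -> R) (k N : nat) (w : Omega) : R :=
  phi (X k w) + \sum_(k.+1 <= n < N.+1) (phi (X n w) - phi (W n w)).

(* If the chains never meet, the estimator is phi (X k w) but every partial sum
   on the right is full, so the bound still holds. *)
Let estim_partial_le (phi : T -> R) (M : R) (k N : nat) (w : Omega) :
  (forall x, `|phi x| <= M) -> (k <= N)%N ->
  exists m, `|estim phi X W k w - partial phi k N w| <=
    0 + \sum_(N <= n < m) (2 * M) * \1_(meet_gt X W n) w.
Proof.
move=> phiM kN.
have M0 : 0 <= M by apply: le_trans (phiM (X 0%N w)).
have h n : `|phi (X n w) - phi (W n w)| <= 2 * M.
  rewrite mulr_natl mulr2n; apply: le_trans (ler_normB _ _) _.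
  by apply: lerD.
have full m : (forall n, (N <= n < m)%N -> meet_gt X W n w) ->
    \sum_(N <= n < m) (2 * M) * \1_(meet_gt X W n) w = (2 * M) *+ (m - N).
  move=> H; rewrite big_nat (eq_bigr (fun=> 2 * M)); last first.
    by move=> n nm; rewrite indicE mem_set ?mulr1//; exact: H.
  by rewrite -big_nat sumr_const_nat.
rewrite /estim /partial opprD addrACA subrr !add0r.
have [[t0 gt]|[t0 XWt Hm]] := meet_timeP _ _ X W w.
  (* The partial sum has [N - k] corrections that the estimator lacks; as many indicators, all equal
     to 1, pay for them. *)
  exists (N + (N - k))%N; rewrite add0r full; last by move=> n _; exact: gt.
  rewrite t0 big_geq// sub0r normrN addKn -(subSS k N).
  by apply: sum_norm_le => n _.
set t := meet_time X W w in t0 XWt Hm *.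
have zero n : (t <= n)%N -> phi (X n w) - phi (W n w) = 0.
  by move=> tn; rewrite (XW_faithful w t t0 XWt n tn) subrr.
have [tN|Nt] := leqP t N.
  exists 0%N; rewrite [X in _ <= _ + X]big_geq// addr0.
  have [tk|kt] := leqP t k.+1.
    rewrite big_geq// big_nat big1 ?subr0 ?normr0// => n /andP[kn _].
    by rewrite zero// (leq_trans tk).
  rewrite [X in _ - X](big_cat_nat (n := t)) ?(ltnW kt)//=; last exact: leqW.
  rewrite opprD addrA subrr sub0r normrN big_nat big1 ?normr0// => n /andP[tn _].
  by rewrite zero.
exists t; rewrite add0r full; last first.
  by move=> n /andP[_ nt]; exact: meet_gt_lt_meet_time.
rewrite (big_cat_nat (n := N.+1))//= addrAC subrr add0r.
apply: le_trans (sum_norm_le _ _ (2 * M) _ _ _) _ => //.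
by rewrite -[leLHS]mulr_natr -[leRHS]mulr_natr ler_wpM2l ?mulr_ge0// ler_nat leq_sub2l.
Qed.

(** The mean of [phi (X N)] serves as intermediate term: it equals the mean of the partial sum up to
    [N], it is close to the mean of the estimator by the tail of the meeting time, and close to the
    target by mixing. *)
Lemma estim_unbiased (pi : probability T R) (C1 rho1 : R) (phi : T -> R)
    (k : nat) :
  0 <= C1 -> 0 < rho1 < 1 ->
  (forall n A, measurable A -> P (W n.+1 @^-1` A) = P (X n @^-1` A)) ->
  (forall n A, measurable A ->
    `|fine (P (X n @^-1` A)) - fine (pi A)| <= C1 * rho1 ^+ n) ->
  measurable_fun setT phi -> is_bounded_fun phi ->
  \int[P]_w estim phi X W k w = \int[pi]_x phi x.
Proof.
move=> C10 /andP[rho10 rho11] WX Xpi mphi [M phiM].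
have M0 : 0 <= M by apply: le_trans (phiM point).
have iX n : P.-integrable setT (EFin \o (fun w => phi (X n w))).
  by apply: (bounded_fun_integrable _ _ _ _ _ M) => //; exact: measurableT_comp.
have iW n : P.-integrable setT (EFin \o (fun w => phi (W n w))).
  by apply: (bounded_fun_integrable _ _ _ _ _ M) => //; exact: measurableT_comp.
have EWX n : \int[P]_w phi (W n.+1 w) = \int[P]_w phi (X n w).
  apply/eqP; rewrite -subr_eq0 -normr_le0 -[leRHS](mulr0 (2 * M + 1)).
  apply: Rintegral_law_dist => // A mA.
  by rewrite WX// subrr normr0.
have ipart N : P.-integrable setT (EFin \o partial phi k N).
  apply: (bounded_fun_integrable _ _ _ _ _ (M + (2 * M) *+ (N.+1 - k.+1))).
    exact: measurable_partial_estim.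
  move=> w; apply: le_trans (ler_normD _ _) _; apply: lerD => //.
  apply: sum_norm_le => n _.
  rewrite mulr_natl mulr2n; apply: le_trans (ler_normB _ _) _.
  by apply: lerD.
have Epart N : (k <= N)%N -> \int[P]_w partial phi k N w = \int[P]_w phi (X N w).
  move=> /subnKC <-; elim: (N - k)%N => [|i IH].
    by apply: eq_Rintegral => w _; rewrite addn0 /partial big_geq// addr0.
  transitivity (\int[P]_w (partial phi k (k + i) w +
      (phi (X (k + i).+1 w) - phi (W (k + i).+1 w)))).
    apply: eq_Rintegral => w _; rewrite /partial addnS big_nat_recr/= ?addrA//.
    by rewrite ltnS leq_addr.
  rewrite RintegralD//; last exact: integrable_EFinB.
  by rewrite IH RintegralB// EWX addnS addrC subrK.
have iest := estim_integrable phi k mphi (ex_intro _ M phiM).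
have mest : measurable_fun setT (estim phi X W k).
  exact: measurable_estim.
have bound1 N : (k <= N)%N ->
    `|\int[P]_w estim phi X W k w - \int[P]_w phi (X N w)| <=
      (2 * M) * C * rho ^+ N / (1 - rho).
  move=> kN; rewrite -Epart// -RintegralB//.
  apply: le_trans (le_normr_Rintegral _ _) _ => //; first exact: integrable_EFinB.
  rewrite /Rintegral -lee_fin fineK; last first.
    apply: integrable_fin_num => //.
    by apply: integrable_norm; exact: integrable_EFinB.
  have mdiff : measurable_fun setT
      (fun w => `|estim phi X W k w - partial phi k N w|).
    apply: measurableT_comp => //; apply: measurable_funB => //.
    exact: measurable_partial_estim.
  apply: le_trans (le_integral_tail R _ _ P _ (cst 0) (fun=> 2 * M)
    (meet_gt X W) N mdiff (measurable_cst _) _ _ _ _ _) _ => //.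
  - exact: measurable_meet_gt.
  - by move=> n; rewrite mulr_ge0.
  - by move=> w; exact: estim_partial_le.
  rewrite integral_cst_probability add0e; apply: eseries_geometric_le => //.
  - by rewrite mulr_ge0// mulr_ge0.
  - by move=> n; rewrite mule_ge0// lee_fin mulr_ge0.
  - move=> n _; rewrite -mulrA [leRHS]EFinM; apply: lee_wpmul2l; last exact: tail.
    by rewrite lee_fin mulr_ge0.
have bound2 N : `|\int[P]_w phi (X N w) - \int[pi]_x phi x| <=
    (2 * M + 1) * C1 * rho1 ^+ N.
  rewrite -mulrA.
  by apply: (Rintegral_law_dist _ _ _ _ _ _ _ _ pi (X N) id) => // A mA; exact: Xpi.
apply/eqP; rewrite -subr_eq0 -normr_le0.
have [/andP[rho0 rho1'] r1] := (rho01, subr_gt0 rho 1).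
(* Both errors decay at least at the larger of the two rates, so one geometric bound covers their
   sum. *)
pose r := Num.max rho rho1.
apply: (@le0_geometric _ _ ((2 * M) * C / (1 - rho) + (2 * M + 1) * C1) r k).
  by rewrite /r lt_max rho0 gt_max rho1' rho11.
move=> N kN.
apply: le_trans (ler_distD (\int[P]_w phi (X N w)) _ _) _.
rewrite mulrDl; apply: lerD.
- apply: le_trans (bound1 N kN) _; rewrite mulrAC ler_wpM2l//.
    by rewrite divr_ge0 ?mulr_ge0// subr_ge0 ltW.
  by rewrite lerXn2r ?nnegrE ?le_max ?lexx// ?(ltW rho0).
- apply: le_trans (bound2 N) _; rewrite ler_wpM2l//.
    by rewrite mulr_ge0// addr_ge0// mulr_ge0.
  by rewrite lerXn2r ?nnegrE ?le_max ?lexx ?orbT// ?(ltW rho10) ?orbT.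
Qed.

End single_estimator.

(** * Increments and independence *)

Section increment.
Context (R : realType) (d dO : measure_display) (T : measurableType d)
  (Omega : measurableType dO) (P : probability Omega R)
  (X1 W1 X2 W2 : nat -> Omega -> T).
Hypothesis mX1 : forall n, measurable_fun setT (X1 n).
Hypothesis mW1 : forall n, measurable_fun setT (W1 n).
Hypothesis mXW1 : forall n, measurable [set w | X1 n w = W1 n w].
Hypothesis mX2 : forall n, measurable_fun setT (X2 n).
Hypothesis mW2 : forall n, measurable_fun setT (W2 n).
Hypothesis mXW2 : forall n, measurable [set w | X2 n w = W2 n w].

Let far n := meet_gt X1 W1 n `|` meet_gt X2 W2 n.

(* Three cases: both chains meet by time N and stay close, which costs the
   first term; they meet by time N but separate on Bad; or some meeting time is
   n + 1 with n >= N, which is charged to the n-th term of the series. *)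
Lemma increment_sq_integral_le (phi : T -> R) (M D : R) (k N : nat)
    (Bad : set Omega) :
  measurable_fun setT phi -> (forall x, `|phi x| <= M) -> (k <= N)%N ->
  measurable Bad ->
  (forall w n, ~ Bad w -> (n <= N)%N ->
    [/\ `|phi (X1 n w) - phi (W1 n w)| <= D,
        `|phi (X2 n w) - phi (W2 n w)| <= D &
        `|phi (X1 n w) - phi (X2 n w)| <= D]) ->
  (\int[P]_w ((estim phi X1 W1 k w - estim phi X2 W2 k w) ^+ 2)%:E <=
    ((D * (1 + 2 * N%:R)) ^+ 2)%:E +
    ((2 * M * (1 + 2 * N%:R)) ^+ 2)%:E * P Bad +
    \sum_(N <= n <oo) (((2 * M * (3 + 2 * n%:R)) ^+ 2)%:E * P (far n)))%E.
Proof.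
move=> mphi phiM kN mBad close.
have M0 : 0 <= M by apply: le_trans (phiM point).
pose b := (2 * M * (1 + 2 * N%:R)) ^+ 2.
pose a := (D * (1 + 2 * N%:R)) ^+ 2.
have me1 := measurable_estim _ _ _ _ _ _ _ mX1 mW1 mXW1 phi k mphi.
have me2 := measurable_estim _ _ _ _ _ _ _ mX2 mW2 mXW2 phi k mphi.
have mfar n : measurable (far n).
  by apply: measurableU; exact: measurable_meet_gt.
have mxi : measurable_fun setT
    (fun w => (estim phi X1 W1 k w - estim phi X2 W2 k w) ^+ 2).
  by apply: measurable_funX; exact: measurable_funB.
have mg : measurable_fun setT (fun w => a + b * \1_Bad w).
  by apply: measurable_funD => //; apply: measurable_funM.
have a0 : 0 <= a by exact: sqr_ge0.
have b0 : 0 <= b by exact: sqr_ge0.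
have -> : (a%:E + b%:E * P Bad = \int[P]_w (a + b * \1_Bad w)%:E)%E.
  under eq_integral do rewrite EFinD (EFinM b).
  rewrite ge0_integralD//.
  - rewrite integral_cst_probability ge0_integralZl//.
    + by rewrite integral_indic// setIT.
    + by apply/measurable_EFinP; exact: measurable_indic.
  - by move=> w _; rewrite mule_ge0.
  - apply: emeasurable_funM => //.
    by apply/measurable_EFinP; exact: measurable_indic.
apply: le_integral_tail => //.
- by move=> w; exact: sqr_ge0.
- by move=> w; rewrite addr_ge0// mulr_ge0.
- by move=> n; exact: sqr_ge0.
move=> w; set xi := _ - _.
pose t1 := meet_time X1 W1 w; pose t2 := meet_time X2 W2 w.
(* A pair that never meets has meeting time 0 and an empty correction sum, so it does not by itself
   push [t] beyond [N]. *)
pose t := maxn t1 t2.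
have crude : `|xi| <= 2 * M * (1 + 2 * t%:R).
  have := estim_norm_le _ _ _ X1 W1 _ _ k w phiM.
  have := estim_norm_le _ _ _ X2 W2 _ _ k w phiM.
  have l1 : M * (1 + 2 * t1%:R) <= M * (1 + 2 * t%:R).
    by rewrite ler_wpM2l// lerD2l ler_wpM2l// ler_nat leq_maxl.
  have l2 : M * (1 + 2 * t2%:R) <= M * (1 + 2 * t%:R).
    by rewrite ler_wpM2l// lerD2l ler_wpM2l// ler_nat leq_maxr.
  move=> h2 h1; apply: le_trans (ler_normB _ _) _.
  apply: le_trans (lerD h1 h2) _; apply: le_trans (lerD l1 l2) _.
  by rewrite le_eqVlt; apply/orP; left; apply/eqP; ring.
have sq_le (x : R) : `|xi| <= x -> xi ^+ 2 <= x ^+ 2.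
  move=> xix; rewrite -real_normK ?num_real// ler_sqr ?nnegrE//.
  exact: le_trans xix.
have [tN|Nt] := leqP t N.
  exists 0%N; rewrite [X in _ <= _ + X]big_geq// addr0.
  have [Bw|Bw] := pselect (Bad w).
    rewrite indicE mem_set// mulr1 ler_wpDl//; apply: sq_le.
    apply: le_trans crude _; rewrite ler_wpM2l ?mulr_ge0// lerD2l ler_wpM2l//.
    by rewrite ler_nat.
  rewrite indicE memNset// mulr0 addr0; apply: sq_le.
  have cl n : (n <= N)%N -> [/\ `|phi (X1 n w) - phi (W1 n w)| <= D,
        `|phi (X2 n w) - phi (W2 n w)| <= D &
        `|phi (X1 n w) - phi (X2 n w)| <= D] by exact: close.
  have D0 : 0 <= D by have [+ _ _] := cl 0%N (leq0n _); exact: le_trans.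
  have s1 : `|\sum_(k.+1 <= n < t1) (phi (X1 n w) - phi (W1 n w))| <= D * N%:R.
    apply: le_trans (sum_norm_le _ _ D _ _ _) _.
      move=> n /andP[_ nt]; have [] // := cl n.
      by rewrite ltnW// (leq_trans nt)// (leq_trans _ tN)// leq_maxl.
    rewrite -[leLHS]mulr_natr ler_wpM2l// ler_nat.
    by rewrite (leq_trans (leq_subr _ _))// (leq_trans _ tN)// leq_maxl.
  have s2 : `|\sum_(k.+1 <= n < t2) (phi (X2 n w) - phi (W2 n w))| <= D * N%:R.
    apply: le_trans (sum_norm_le _ _ D _ _ _) _.
      move=> n /andP[_ nt]; have [] // := cl n.
      by rewrite ltnW// (leq_trans nt)// (leq_trans _ tN)// leq_maxr.
    rewrite -[leLHS]mulr_natr ler_wpM2l// ler_nat.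
    by rewrite (leq_trans (leq_subr _ _))// (leq_trans _ tN)// leq_maxr.
  have [_ _ s0] := cl k kN.
  rewrite /xi /estim opprD addrACA.
  (* One [D] pays for the difference at time [k], and [D * N%:R] for each of the two correction
     sums. *)
  have -> : D * (1 + 2 * N%:R) = D + (D * N%:R + D * N%:R) by ring.
  apply: le_trans (ler_normD _ _) _; apply: lerD => //.
  by apply: le_trans (ler_normB _ _) _; exact: lerD.
exists t; apply: ler_wpDl; first by rewrite addr_ge0// mulr_ge0.
case E : t Nt crude => [//|n]; rewrite ltnS => Nn crude.
rewrite big_nat_recr//= ler_wpDl//.
  by rewrite sumr_ge0// => i _; rewrite mulr_ge0// sqr_ge0.
have farn : far n w.
  have : (n < t)%N by rewrite E.
  rewrite /t leq_max => /orP[] ?; [left|right]; exact: meet_gt_lt_meet_time.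
rewrite indicE mem_set// mulr1; apply: sq_le.
by have <- : 1 + 2 * n.+1%:R = 3 + 2 * n%:R :> R by rewrite -natr1; ring.
Qed.

End increment.

Section independence.
Context (R : realType) (dO : measure_display) (Omega : measurableType dO)
  (P : probability Omega R) (G : set (set Omega)).
Hypothesis Gm : G `<=` measurable.
Let Om' := g_sigma_algebraType G.
Variables (A : set Omega) (p : R).
Hypothesis mA : measurable A.
Hypothesis p0 : 0 <= p.
Hypothesis indep : forall E, <<s G >> E -> P (A `&` E) = (p%:E * P E)%E.

Lemma measurable_fun_sub (f : Omega -> R) :
  measurable_fun (setT : set Om') (f : Om' -> R) -> measurable_fun setT f.
Proof.
move=> mf _ B mB.
have : <<s G >> (setT `&` f @^-1` B) by exact: mf.
apply: (smallest_sub _ Gm); exact: sigma_algebra_measurable.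
Qed.

(** On the sigma-algebra generated by [G], the restriction of [P] to [A] and the multiple [p] of [P]
    coincide, so a function measurable for it has the same law under both. *)
Lemma integral_indep_ge0 (f : Omega -> R) : (forall w, 0 <= f w) ->
  measurable_fun (setT : set Om') (f : Om' -> R) ->
  (\int[P]_(w in A) (f w)%:E = p%:E * \int[P]_w (f w)%:E)%E.
Proof.
move=> f0 mf; have mf' := measurable_fun_sub f mf.
pose PA := mrestr P mA.
have restr : (\int[P]_(w in A) (f w)%:E = \int[PA]_w (f w)%:E)%E.
  transitivity (\int[PA]_(w in A) (f w)%:E)%E.
    by apply: eq_measure_integral => B mB BA; rewrite /PA /= /mrestr setIidl.
  rewrite -[in RHS](setUv A) ge0_integral_setU//.
  - rewrite (_ : \int[PA]_(w in ~` A) (f w)%:E = 0)%E ?adde0//.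
    apply: null_set_integral => //.
    + exact: measurableC.
    + by apply/measurable_funTS/measurable_EFinP.
    + by rewrite /PA /= /mrestr setICl measure0.
  - exact: measurableC.
  - by apply/measurable_funTS/measurable_EFinP.
  - by move=> w _; rewrite lee_fin.
  - exact/disj_setPCl.
rewrite {}restr.
rewrite -[RHS](ge0_integral_mscale P measurableT (NngNum p0))//; last 2 first.
- exact/measurable_EFinP.
- by move=> w _; rewrite lee_fin.
(* Writing [f] as its own absolute value makes the integrand a function of [f] that is nonnegative
   on the whole line, as [integral_eq_law] requires. *)
under eq_integral do rewrite -(ger0_norm (f0 _)).
under [RHS]eq_integral do rewrite -(ger0_norm (f0 _)).
apply: (integral_eq_law _ _ _ _ _ _ _ PA (mscale (NngNum p0) P) f f
  (fun x => `|x|%:E)) => //.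
- by apply/measurable_EFinP; exact: normr_measurable.
- move=> B mB; rewrite /PA /= /mrestr /mscale/= setIC; apply: indep.
  by rewrite -[_ @^-1` _]setTI; exact: mf.
Qed.

Lemma integral_indep (f : Omega -> R) : P.-integrable setT (EFin \o f) ->
  measurable_fun (setT : set Om') (f : Om' -> R) ->
  (\int[P]_(w in A) (f w)%:E = p%:E * \int[P]_w (f w)%:E)%E.
Proof.
move=> fi mf.
have mp : measurable_fun (setT : set Om') (f^\+ : Om' -> R).
  exact: measurable_funrpos.
have mn : measurable_fun (setT : set Om') (f^\- : Om' -> R).
  exact: measurable_funrneg.
have E (D : set Omega) : (\int[P]_(w in D) (f w)%:E =
   \int[P]_(w in D) (f^\+ w)%:E - \int[P]_(w in D) (f^\- w)%:E)%E.
  rewrite integralE; congr (_ - _)%E; apply: eq_integral => w _.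
  - by rewrite funeposE /funrpos EFin_max.
  - by rewrite funenegE /funrneg EFin_max.
rewrite !E !integral_indep_ge0//.
have : (\int[P]_w (f^\+ w)%:E)%E \is a fin_num.
  by apply: integrable_fin_num => //; exact: integrable_funrpos.
move: (\int[P]_w (f^\+ w)%:E)%E (\int[P]_w (f^\- w)%:E)%E => a b afin.
by rewrite muleBr// fin_num_adde_defr.
Qed.

End independence.

(** * The single-term estimator *)

(** On the event that [L] is [l], independence produces a factor [pL l]. It cancels the weight in
    the mean, and one of the two weights in the second moment, which leaves the series assumed
    finite. *)
Lemma single_term_estimator (R : realType) (dO : measure_display)
    (Omega : measurableType dO) (P : probability Omega R)
    (G : set (set Omega)) (L : Omega -> nat) (pL : nat -> R)
    (zeta : nat -> Omega -> R) (c : nat -> R) :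
  G `<=` measurable ->
  measurable_fun setT L -> (forall l, 0 < pL l) ->
  (forall l, P (L @^-1` [set l]) = (pL l)%:E) ->
  (forall Bs E, <<s G >> E ->
    P (L @^-1` Bs `&` E) = (fine (P (L @^-1` Bs)) * fine (P E))%:E) ->
  (forall l, measurable_fun (setT : set (g_sigma_algebraType G))
    (zeta l : g_sigma_algebraType G -> R)) ->
  (forall l, (\int[P]_w (zeta l w ^+ 2)%:E <= (c l)%:E)%E) ->
  (\sum_(0 <= l <oo) ((pL l)^-1 * c l)%:E < +oo)%E ->
  (\int[P]_w (((pL (L w))^-1 * zeta (L w) w) ^+ 2)%:E < +oo)%E /\
  (\int[P]_w ((pL (L w))^-1 * zeta (L w) w)%:E =
     \sum_(0 <= l <oo) \int[P]_w (zeta l w)%:E)%E.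
Proof.
move=> Gm mL pL0 PL indep mz zc csum.
have mz' l : measurable_fun setT (zeta l) by apply: measurable_fun_sub; [exact: Gm|].
set Y := fun w => (pL (L w))^-1 * zeta (L w) w.
have mY : measurable_fun setT Y.
  apply: (measurable_fun_nat_select _ _ _ L (fun l w => (pL l)^-1 * zeta l w)) => //.
  by move=> l; exact: measurable_funM.
have mLl l : measurable (L @^-1` [set l]).
  by rewrite -(setTI (_ @^-1` _)); exact: mL.
have cover : \bigcup_l (L @^-1` [set l]) = setT.
  by apply/seteqP; split => // w _; exists (L w).
have triv : trivIset setT (fun l => L @^-1` [set l]).
  by apply/trivIsetP => i j _ _ ij; apply/seteqP; split => // w [/= -> /eqP]; rewrite (negbTE ij).
have indep_l l E : <<s G >> E -> P (L @^-1` [set l] `&` E) = ((pL l)%:E * P E)%E.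
  move=> GE; rewrite indep// PL/= EFinM fineK//.
  apply: fin_num_measure.
  by move: GE; apply: smallest_sub => //; exact: sigma_algebra_measurable.
have Y2 : (\int[P]_w (Y w ^+ 2)%:E < +oo)%E.
  rewrite -cover ge0_integral_bigcup//; last 2 first.
  - by rewrite cover; apply/measurable_EFinP; exact: measurable_funX.
  - by move=> w _; rewrite lee_fin sqr_ge0.
  apply: le_lt_trans csum; apply: lee_nneseries => l _.
    by move=> _; apply: integral_ge0 => w _; rewrite lee_fin sqr_ge0.
  rewrite (eq_integral (fun w => (((pL l)^-1 * zeta l w) ^+ 2)%:E)); last first.
    by move=> w /[!inE] /= Lw; rewrite /Y Lw.
  rewrite (integral_indep_ge0 _ _ _ P G Gm _ (pL l) (mLl l) (ltW (pL0 l)) (indep_l l)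
    (fun w => ((pL l)^-1 * zeta l w) ^+ 2)); last 2 first.
  - by move=> w; exact: sqr_ge0.
  - by apply: measurable_funX; exact: measurable_funM.
  under eq_integral do rewrite exprMn EFinM.
  rewrite ge0_integralZl//; last 3 first.
  - by apply/measurable_EFinP; exact: measurable_funX.
  - by move=> w _; rewrite lee_fin sqr_ge0.
  - by rewrite lee_fin sqr_ge0.
  rewrite muleA -EFinM expr2 mulrA divff ?mul1r ?lt0r_neq0// EFinM.
  by apply: lee_wpmul2l => //; rewrite lee_fin invr_ge0 ltW.
split => //.
(* The second moment had to come first: it gives the integrability that allows the signed integral
   to be split over the values of [L]. *)
have iY := sq_integrable_integrable _ _ _ P Y mY Y2.
rewrite -[in LHS]cover integral_bigcup//; last by rewrite cover.
apply: eq_eseriesr => l _.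
rewrite (eq_integral (fun w => ((pL l)^-1 * zeta l w)%:E)); last first.
  by move=> w /[!inE] /= Lw; rewrite /Y Lw.
have iz : P.-integrable setT (EFin \o zeta l).
  by apply: sq_integrable_integrable => //; apply: le_lt_trans (zc l) _; exact: ltry.
have iz' : P.-integrable setT (EFin \o (fun w => (pL l)^-1 * zeta l w)).
  exact: (integrableZl measurableT (pL l)^-1 iz).
rewrite (integral_indep _ _ _ P G Gm _ (pL l) (mLl l) (ltW (pL0 l)) (indep_l l)
    (fun w => (pL l)^-1 * zeta l w))//; last exact: measurable_funM.
under eq_integral do rewrite EFinM.
by rewrite (integralZl measurableT iz) muleA -EFinM divff ?lt0r_neq0// mul1e.
Qed.

(** * Geometric rates and the geometric law *)

Lemma Delta_powE (R : realType) (l : nat) (beta : R) :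
  Delta_pow l beta = (2^-1 `^ beta) ^+ l.
Proof.
have h0 : 0 <= 2^-1 :> R by [].
rewrite /Delta_pow -exprVn -(powR_mulrn l h0).
by rewrite -(powR_mulrn l (powR_ge0 _ _)) -!powRrM mulrC.
Qed.

Lemma half_powR_lt1 (R : realType) (beta : R) : 0 < beta ->
  0 < (2^-1 `^ beta : R) < 1.
Proof.
move=> b0; rewrite powR_gt0//=.
have : (2^-1 : R) `^ beta < 1 `^ beta.
  by apply: gt0_ltr_powR; rewrite ?nnegrE// invf_lt1// ltr1n.
by rewrite powR1.
Qed.

(** The quadratic bound is applied twice at [l + k], and division by [rho ^+ k] restores the
    exponent [l]. The fourth power leaves room for a squared number of summands times the number of
    possible exit times. *)
Lemma quartic_geometric_le (R : realType) (rho : R) (k : nat) : 0 < rho < 1 ->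
  exists r C : R, [/\ 0 < r < 1, 0 <= C &
    forall l : nat, (3 + 2 * (l + k)%:R) ^+ 4 * rho ^+ l <= C * r ^+ l].
Proof.
move=> rho01.
have [r1 [C1 [r101 C10 H1]]] := square_geometric_le _ _ rho01.
have [r [C [r01 C0 H]]] := square_geometric_le _ _ r101.
exists r, (C1 * C / rho ^+ k); have [p0 _] := andP rho01.
have [r0 r1'] := andP r01.
split => //; first by rewrite divr_ge0 ?mulr_ge0// exprn_ge0// ltW.
move=> l; rewrite -(ler_pM2r (exprn_gt0 k p0)).
rewrite [leRHS]mulrAC divfK ?lt0r_neq0 ?exprn_gt0// -mulrA -exprD.
have := H1 (l + k)%N; have := H (l + k)%N; set x := 3 + _.
have -> : x ^+ 4 = x ^+ 2 * x ^+ 2 by rewrite -exprD.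
move=> h h1; rewrite -mulrA.
apply: le_trans (ler_wpM2l (sqr_ge0 x) h1) _; rewrite mulrCA.
apply: le_trans (ler_wpM2l C10 h) _; rewrite mulrA ler_wpM2l ?mulr_ge0//.
by rewrite exprD ler_piMr ?exprn_ge0 ?exprn_ile1// ltW.
Qed.

Lemma geometric_pmf (R : realType) (q : R) : 0 < q < 1 ->
  (\sum_(0 <= l <oo) ((1 - q) * q ^+ l)%:E = 1)%E.
Proof.
move=> /andP[q0 q1].
under eq_fun do rewrite sumEFin.
apply/cvg_lim => //; apply: cvg_EFin; first by near=> n.
have := @cvg_geometric_series _ (1 - q) q.
rewrite ger0_norm ?(ltW q0)// q1 => /(_ isT).
by rewrite divff// subr_eq0 eq_sym lt_eqF.
Unshelve. all: by end_near.
Qed.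

(** * One level of the coupled chains *)

Section level.
Context (R : realType) (d dS dO : measure_display) (T : measurableType d)
  (S : measurableType dS) (Omega : measurableType dO)
  (P : probability Omega R) (K : R.-pker T ~> T) (Kc : R.-pker S ~> S)
  (q : S -> T * T) (Z : nat -> Omega -> S) (pi nu : probability T R)
  (nut : probability (T * T)%type R).
Hypothesis mq : measurable_fun setT q.
Hypothesis Kc1 : forall z A, measurable A ->
  Kc z ((fun z' => (q z').1) @^-1` A) = K (q z).1 A.
Hypothesis Kc2 : forall z A, measurable A ->
  Kc z ((fun z' => (q z').2) @^-1` A) = K (q z).2 A.
Hypothesis HZ : markov_chain P Z Kc.
Hypothesis Zinit : forall C, measurable C ->
  P ((fun w => q (Z 0%N w)) @^-1` C) = check_nu nut K C.
Hypothesis Hnut : forall A : set T, measurable A ->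
  nut (A `*` setT) = nu A /\ nut (setT `*` A) = nu A.

Let X n w := (q (Z n w)).1.
Let W n w := (q (Z n w)).2.

Let mq1 : measurable_fun setT (fun z => (q z).1).
Proof. exact: (measurableT_comp measurable_fst mq). Qed.

Let mq2 : measurable_fun setT (fun z => (q z).2).
Proof. exact: (measurableT_comp measurable_snd mq). Qed.

Lemma level_measurable1 n : measurable_fun setT (X n).
Proof. exact: (measurableT_comp mq1 (HZ.1 n)). Qed.

Lemma level_measurable2 n : measurable_fun setT (W n).
Proof. exact: (measurableT_comp mq2 (HZ.1 n)). Qed.

(** The first coordinate of the initial pair has already made one step of [K], hence the index
    [n.+1]; this step merges with the later ones by the definition of [kiter]. *)
Lemma level_law1 n A : measurable A ->
  P (X n @^-1` A) = (\int[nu]_x kiter K n.+1 x A)%E.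
Proof.
move=> mA; rewrite (law_projection _ _ _ _ _ _ _ _ K Kc _ Z mq1 Kc1 HZ)//.
apply: (integral_kernel_mixture _ _ _ _ _ P nu K (X 0%N)) => //.
- exact: level_measurable1.
- exact: measurable_kiter.
- by move=> x; exact: kiter_ge0.
move=> B mB; rewrite -(check_nu_fst _ _ _ nu nut K Hnut)// -Zinit.
  by congr (P _); apply/seteqP; split => w //= [].
exact: measurableX.
Qed.

Lemma level_law2 n A : measurable A ->
  P (W n @^-1` A) = (\int[nu]_x kiter K n x A)%E.
Proof.
move=> mA; rewrite (law_projection _ _ _ _ _ _ _ _ K Kc _ Z mq2 Kc2 HZ)//.
apply: (integral_eq_law _ _ _ _ _ _ _ P nu (W 0%N) id (fun x => kiter K n x A)) => //.
- exact: level_measurable2.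
- exact: measurable_kiter.
- by move=> x; exact: kiter_ge0.
move=> B mB; transitivity (nu B) => //.
rewrite -(check_nu_snd _ _ _ nu nut K Hnut)// -Zinit.
  by congr (P _); apply/seteqP; split => w //= [].
exact: measurableX.
Qed.

Variables (C1 rho1 C rho : R) (dm : T -> T -> R).
Hypothesis rho101 : 0 < rho1 < 1.
Hypothesis mixing : forall x n A, (0 < n)%N -> measurable A ->
  (`| kiter K n x A - pi A | <= (C1 * rho1 ^+ n)%:E)%E.
Hypothesis dm_metric : is_metric dm.
Hypothesis mdm : measurable_fun setT (fun z : T * T => dm z.1 z.2).
Hypothesis C0 : 0 <= C.
Hypothesis rho01 : 0 < rho < 1.
Hypothesis tail : forall n, (P (meet_gt X W n) <= (C * rho ^+ n)%:E)%E.
Hypothesis XW_faithful : faithful X W.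

Lemma level_coincidence n : measurable [set w | X n w = W n w].
Proof.
apply: (measurable_coincidence _ _ _ _ _ dm) => //.
- exact: level_measurable1.
- exact: level_measurable2.
Qed.

Let C10 : 0 <= C1.
Proof.
have [r0 _] := andP rho101.
have := mixing point 1%N setT isT measurableT.
move/(le_trans (abse_ge0 _)); rewrite lee_fin expr1 pmulr_lge0//.
Qed.

(** The law of [X n] averages [kiter] at [n.+1] over [nu], so the mixing bound, stated from one step
    on, also applies at [n = 0]. The surplus factor [rho1] is dropped at the end. *)
Lemma level_mixing n A : measurable A ->
  `|fine (P (X n @^-1` A)) - fine (pi A)| <= C1 * rho1 ^+ n.
Proof.
move=> mA; have [r0 r1] := andP rho101.
pose e := C1 * rho1 ^+ n.+1; pose a := fine (pi A).
have piA : pi A = a%:E by rewrite fineK// fin_num_measure.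
(* [kiter] is an iterated integral with extended real values; being within a finite distance of the
   finite [pi A] makes it finite. *)
have kfin x : kiter K n.+1 x A \is a fin_num.
  have := mixing x n.+1 A isT mA; rewrite piA.
  have := kiter_ge0 _ _ _ K n.+1 x A.
  by case: (kiter K n.+1 x A).
pose h x := fine (kiter K n.+1 x A).
have he x : `|h x - a| <= e.
  by have := mixing x n.+1 A isT mA; rewrite piA -(fineK (kfin x)) lee_fin.
have mh : measurable_fun setT h.
  by apply: measurableT_comp => //; exact: measurable_kiter.
have ih : nu.-integrable setT (EFin \o h).
  apply: (bounded_fun_integrable _ _ _ _ _ (e + `|a|)) => // x.
  by rewrite -lerBlDr; apply: le_trans (lerB_dist _ _) (he x).
have -> : fine (P (X n @^-1` A)) = \int[nu]_x h x.
  rewrite level_law1// /Rintegral; congr fine.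
  by apply: eq_integral => x _; rewrite fineK.
have ia : nu.-integrable setT (EFin \o cst a).
  exact/finite_measure_integrable_cst.
rewrite -/a -[X in _ - X](Rintegral_cst_probability _ _ _ nu) -RintegralB//.
apply: le_trans (le_normr_Rintegral _ _) _ => //; first exact: integrable_EFinB.
apply: (@le_trans _ _ (\int[nu]_x e)).
  apply: le_Rintegral => //.
  - exact/integrable_norm/integrable_EFinB.
  - exact/finite_measure_integrable_cst.
rewrite Rintegral_cst_probability /e exprS ler_wpM2l// ler_piMl// ?exprn_ge0//.
- exact: ltW.
- exact: ltW.
Qed.

(** Used with [q] equal to [id] for the level-0 chain, and to [fst] and [snd] for the two halves of
    an increment chain. *)
Lemma level_unbiased (phi : T -> R) (k : nat) :
  measurable_fun setT phi -> is_bounded_fun phi ->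
  \int[P]_w estim phi X W k w = \int[pi]_x phi x.
Proof.
move=> mphi bphi.
apply: (estim_unbiased _ _ _ _ _ _ _ _ C rho _ _ _ _ _ _ _ pi C1 rho1) => //.
- exact: level_measurable1.
- exact: level_measurable2.
- exact: level_coincidence.
- by move=> n A mA; rewrite level_law1// level_law2.
- exact: level_mixing.
Qed.

End level.

(** * Leaving the set where the coordinates are close *)

Lemma measurable_B_set (R : realType) (d : measure_display)
    (T : measurableType d) (dm : T -> T -> R) (C beta : R) (l : nat) :
  measurable_fun setT (fun z : T * T => dm z.1 z.2) ->
  measurable (B_set dm C beta l : set ((T * T) * (T * T))).
Proof.
move=> mdm.
have mc i : measurable_fun setT (fun z : (T * T) * (T * T) => coord4 z i).
  have m11 : measurable_fun setT (fun z : (T * T) * (T * T) => z.1.1).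
    exact: (measurableT_comp measurable_fst measurable_fst).
  have m12 : measurable_fun setT (fun z : (T * T) * (T * T) => z.1.2).
    exact: (measurableT_comp measurable_snd measurable_fst).
  have m21 : measurable_fun setT (fun z : (T * T) * (T * T) => z.2.1).
    exact: (measurableT_comp measurable_fst measurable_snd).
  have m22 : measurable_fun setT (fun z : (T * T) * (T * T) => z.2.2).
    exact: (measurableT_comp measurable_snd measurable_snd).
  (* From index 4 on, [nth] returns its default [z.1.1]. *)
  case: i => [//|[//|[//|[//|i]]]].
  rewrite (_ : (fun z => _) = (fun z : (T * T) * (T * T) => z.1.1))//.
  by apply/funext => z; rewrite /coord4 nth_default.
have -> : B_set dm C beta l =
    \bigcap_(i in [set i | (i < 4)%N]) \bigcap_(j in [set j | (j < 4)%N])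
      (fun z => dm (coord4 z i) (coord4 z j)) @^-1` `]-oo, C * Delta_pow l beta]%classic.
  apply/seteqP; split => z /=.
    by move=> H i i4 j j4 /=; rewrite in_itv/=; exact: H.
  by move=> H i j i4 j4; have := H i i4 j j4; rewrite /= in_itv.
apply: bigcap_measurableType => i _; apply: bigcap_measurableType => j _.
rewrite -(setTI (_ @^-1` _)).
have mp : measurable_fun setT
    (fun z : (T * T) * (T * T) => (coord4 z i, coord4 z j)).
  by apply: measurable_fun_pair; exact: mc.
by apply: (measurableT_comp mdm mp).
Qed.

(* Leaving B before time N happens either at time 0 or at a first exit. *)
Lemma exit_probability_le (R : realType) (dS dO : measure_display)
    (S : measurableType dS) (Omega : measurableType dO)
    (P : probability Omega R) (Z : nat -> Omega -> S) (B : set S) (e : R)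
    (N : nat) :
  (forall n, measurable_fun setT (Z n)) -> measurable B ->
  (P (Z 0%N @^-1` (~` B)) <= e%:E)%E ->
  (forall n, (0 < n)%N -> (P [set w | ~ B (Z n w) /\ B (Z n.-1 w)] <= e%:E)%E) ->
  (P [set w | exists2 n, (n <= N)%N & ~ B (Z n w)] <= (N.+1%:R * e)%:E)%E.
Proof.
move=> mZ mB e0 eS.
pose exit n := if n is m.+1 then [set w | ~ B (Z n w) /\ B (Z m w)]
               else Z 0%N @^-1` (~` B).
have mZB n : measurable (Z n @^-1` B).
  by rewrite -(setTI (_ @^-1` _)); exact: mZ.
have mexit n : measurable (exit n).
  case: n => [|n]; first exact: (measurableC (mZB 0%N)).
  exact: (measurableI _ _ (measurableC (mZB n.+1)) (mZB n)).
have eexit n : (P (exit n) <= e%:E)%E by case: n => [//|n]; exact: eS n.+1 isT.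
have exitE : [set w | exists2 n, (n <= N)%N & ~ B (Z n w)] =
    \big[setU/set0]_(n < N.+1) exit n.
  rewrite -bigcup_mkord; apply/seteqP; split => w.
    move=> [n nN Bn]; elim: n nN Bn => [|n IH] nN Bn; first by exists 0%N.
    have [Bw|Bw] := pselect (B (Z n w)); last by apply: IH => //; exact: ltnW.
    by exists n.+1.
  move=> [[|n] /= nN]; first by exists 0%N.
  by move=> [Bn _]; exists n.+1.
rewrite exitE; apply: (@le_trans _ _ (\sum_(n < N.+1) P (exit n))%E).
  apply: content_subadditive => //.
  by apply: bigsetU_measurable.
apply: (@le_trans _ _ (\sum_(n < N.+1) e%:E)%E); first exact: lee_sum.
by rewrite sumEFin sumr_const card_ord mulr_natl.
Qed.

(** * Decay rate of the increments *)

Section increment_rate.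
Context (R : realType) (d dO : measure_display) (T : measurableType d)
  (Omega : measurableType dO) (P : probability Omega R) (dm : T -> T -> R)
  (Z : nat -> nat -> Omega -> (T * T) * (T * T)) (k : nat)
  (C rho C5 beta eps : R).
Hypothesis dm_metric : is_metric dm.
Hypothesis mdm : measurable_fun setT (fun z : T * T => dm z.1 z.2).
Hypothesis mZ : forall l n, (0 < l)%N -> measurable_fun setT (Z l n).
Hypothesis C0 : 0 <= C.
Hypothesis rho01 : 0 < rho < 1.
Hypothesis tail1 : forall l n, (0 < l)%N ->
  (P (meet_gt (pX (upper (Z l))) (pW (upper (Z l))) n) <= (C * rho ^+ n)%:E)%E.
Hypothesis tail2 : forall l n, (0 < l)%N ->
  (P (meet_gt (pX (lower (Z l))) (pW (lower (Z l))) n) <= (C * rho ^+ n)%:E)%E.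
Hypothesis beta0 : 0 < beta.
Hypothesis eps0 : 0 < eps.
Hypothesis start : forall l, (0 < l)%N ->
  (P (Z l 0%N @^-1` (~` B_set dm C5 beta l))
     <= (C5 * Delta_pow l (beta * (2 + eps)))%:E)%E.
Hypothesis exit : forall l n, (0 < l)%N -> (0 < n)%N ->
  (P [set w | ~ B_set dm C5 beta l (Z l n w) /\ B_set dm C5 beta l (Z l n.-1 w)]
     <= (C5 * Delta_pow l (beta * (2 + eps)))%:E)%E.

Let C50 : 0 <= C5.
Proof.
have := le_trans (measure_ge0 P _) (start 1%N isT).
by rewrite lee_fin pmulr_lge0// powR_gt0.
Qed.

Lemma increment_rate : exists r : R, 0 < r < 1 /\
  forall phi : T -> R,
    measurable_fun setT phi -> is_bounded_fun phi -> is_lipschitz dm phi ->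
    exists c : R, 0 <= c /\ forall l, (0 < l)%N ->
      (\int[P]_w ((estim phi (pX (upper (Z l))) (pW (upper (Z l))) k w -
         estim phi (pX (lower (Z l))) (pW (lower (Z l))) k w) ^+ 2)%:E
       <= (c * r ^+ l)%:E)%E.
Proof.
pose a := (2^-1 : R) `^ beta.
have a01 : 0 < a < 1 by exact: half_powR_lt1.
have aa01 : 0 < a ^+ 2 < 1.
  have /andP[a0 a1] := a01.
  by rewrite exprn_gt0//= expr_lt1// ltW.
pose b := (2^-1 : R) `^ (beta * (2 + eps)).
have b01 : 0 < b < 1 by apply: half_powR_lt1; rewrite mulr_gt0// addr_gt0.
have [r1 [K1 [r101 K10 H1]]] := quartic_geometric_le R _ k aa01.
have [r2 [K2 [r201 K20 H2]]] := quartic_geometric_le R _ k b01.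
have [r3 [K3 [r301 K30 H3]]] := square_geometric_le R _ rho01.
(* [r1] comes from the squared distance inside [B_set], [r2] from the probability of leaving it,
   [r3] from late meetings. *)
pose r := Num.max r1 (Num.max r2 r3).
have [r10 r11] := andP r101.
have [r20 r21] := andP r201.
have [r30 r31] := andP r301.
have r0 : 0 < r by rewrite lt_max r10.
have r1r l : r1 ^+ l <= r ^+ l.
  by rewrite lerXn2r ?nnegrE ?(ltW r10) ?(ltW r0)// le_max lexx.
have r2r l : r2 ^+ l <= r ^+ l.
  by rewrite lerXn2r ?nnegrE ?(ltW r20) ?(ltW r0)// !le_max lexx orbT.
have r3r l : r3 ^+ l <= r ^+ l.
  by rewrite lerXn2r ?nnegrE ?(ltW r30) ?(ltW r0)// !le_max lexx !orbT.
exists r; split; first by rewrite r0 !gt_max r11 r21 r31.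
move=> phi mphi [M phiM] [c0 lip].
(* The sign of [c0] is not prescribed by [is_lipschitz]; the absolute value keeps the later products
   monotone. *)
pose c := `|c0|.
have c_ge0 : 0 <= c by exact: normr_ge0.
have M0 : 0 <= M by apply: le_trans (phiM point).
have [dm0 _ _ _] := dm_metric.
have lipc x w : `|phi x - phi w| <= c * dm x w.
  by apply: le_trans (lip x w) _; rewrite ler_wpM2r// ler_norm.
pose c1 := (c * C5) ^+ 2 * K1.
pose c2 := (2 * M) ^+ 2 * C5 * K2.
pose c3 := (2 * M) ^+ 2 * (2 * C) * K3 / (1 - r3).
have c10 : 0 <= c1 by rewrite mulr_ge0// sqr_ge0.
have c20 : 0 <= c2 by rewrite !mulr_ge0// sqr_ge0.
have c30 : 0 <= c3.
  by rewrite divr_ge0 ?subr_ge0 ?(ltW r31)// mulr_ge0// mulr_ge0 ?sqr_ge0// mulr_ge0.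
exists (c1 + c2 + c3); split; first by rewrite !addr_ge0.
move=> l l0; pose N := (l + k)%N.
pose D := c * (C5 * a ^+ l).
pose B := B_set dm C5 beta l : set ((T * T) * (T * T)).
pose Bad := [set w | exists2 n, (n <= N)%N & ~ B (Z l n w)].
have mB : measurable B by exact: measurable_B_set.
have mBad : measurable Bad.
  have -> : Bad = \bigcup_(n in [set n | (n <= N)%N]) Z l n @^-1` (~` B).
    by apply/seteqP; split => w [n nN Bn]; exists n.
  apply: bigcup_measurable => n _; rewrite -(setTI (_ @^-1` _)).
  by apply: mZ => //; exact: measurableC.
have PBad : (P Bad <= (N.+1%:R * (C5 * b ^+ l))%:E)%E.
  rewrite -Delta_powE; apply: exit_probability_le => //.
  - by move=> n; exact: mZ.
  - exact: start.
  - by move=> n n0; exact: exit.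
have m11 n : measurable_fun setT (pX (upper (Z l)) n).
  exact: (measurableT_comp measurable_fst (measurableT_comp measurable_fst (mZ l n l0))).
have m12 n : measurable_fun setT (pW (upper (Z l)) n).
  exact: (measurableT_comp measurable_snd (measurableT_comp measurable_fst (mZ l n l0))).
have m21 n : measurable_fun setT (pX (lower (Z l)) n).
  exact: (measurableT_comp measurable_fst (measurableT_comp measurable_snd (mZ l n l0))).
have m22 n : measurable_fun setT (pW (lower (Z l)) n).
  exact: (measurableT_comp measurable_snd (measurableT_comp measurable_snd (mZ l n l0))).
have me1 n := measurable_coincidence _ _ _ _ _ dm _ _ dm_metric mdm (m11 n) (m12 n).
have me2 n := measurable_coincidence _ _ _ _ _ dm _ _ dm_metric mdm (m21 n) (m22 n).
have close w n : ~ Bad w -> (n <= N)%N ->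
   [/\ `|phi (pX (upper (Z l)) n w) - phi (pW (upper (Z l)) n w)| <= D,
       `|phi (pX (lower (Z l)) n w) - phi (pW (lower (Z l)) n w)| <= D &
       `|phi (pX (upper (Z l)) n w) - phi (pX (lower (Z l)) n w)| <= D].
  move=> Bw nN; have {}Bw : B (Z l n w).
    by apply: contrapT => Bn; apply: Bw; exists n.
  have h i j : (i < 4)%N -> (j < 4)%N ->
      `|phi (coord4 (Z l n w) i) - phi (coord4 (Z l n w) j)| <= D.
    move=> i4 j4; apply: le_trans (lipc _ _) _; rewrite ler_wpM2l//.
    by rewrite -Delta_powE; exact: Bw.
  by split; [exact: (h 0%N 1%N)|exact: (h 2%N 3%N)|exact: (h 0%N 2%N)].
apply: le_trans (increment_sq_integral_le _ _ _ _ _ P _ _ _ _ m11 m12 me1 m21 m22 me2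
  phi M D k N Bad mphi phiM (leq_addl _ _) mBad close) _.
pose x : R := 3 + 2 * N%:R.
have x1 : 1 <= x by rewrite /x; have : 0 <= N%:R :> R by []; lra.
have x0 : 0 <= x by exact: le_trans x1.
have y0 : 0 <= 1 + 2 * N%:R :> R by rewrite addr_ge0// mulr_ge0.
have yx : 1 + 2 * N%:R <= x by rewrite /x lerD2r; lra.
have y2x2 : (1 + 2 * N%:R) ^+ 2 <= x ^+ 2 by rewrite ler_sqr ?nnegrE.
have x2x4 : x ^+ 2 <= x ^+ 4 by rewrite ler_weXn2l.
have l1 : (D * (1 + 2 * N%:R)) ^+ 2 <= c1 * r ^+ l.
  rewrite /D mulrA exprMn exprMn -[(a ^+ l) ^+ 2]exprM mulnC exprM.
  rewrite -mulrA /c1 -[leRHS]mulrA ler_wpM2l ?sqr_ge0//.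
  apply: (@le_trans _ _ (x ^+ 4 * (a ^+ 2) ^+ l)).
    rewrite mulrC ler_wpM2r ?exprn_ge0 ?(ltW (andP a01).1)//.
    exact: le_trans x2x4.
  by apply: le_trans (H1 l) _; rewrite ler_wpM2l.
have l2 : (((2 * M * (1 + 2 * N%:R)) ^+ 2)%:E * P Bad <= (c2 * r ^+ l)%:E)%E.
  apply: le_trans (lee_wpmul2l _ PBad) _; first by rewrite lee_fin sqr_ge0.
  rewrite -EFinM lee_fin exprMn.
  apply: (@le_trans _ _ ((2 * M) ^+ 2 * C5 * (x ^+ 4 * b ^+ l))); last first.
    rewrite /c2 -[leRHS]mulrA ler_wpM2l ?mulr_ge0 ?sqr_ge0//.
    by apply: le_trans (H2 l) _; rewrite ler_wpM2l.
  have -> : (2 * M) ^+ 2 * (1 + 2 * N%:R) ^+ 2 * (N.+1%:R * (C5 * b ^+ l)) =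
     (2 * M) ^+ 2 * C5 * (((1 + 2 * N%:R) ^+ 2 * N.+1%:R) * b ^+ l) by ring.
  rewrite ler_wpM2l ?mulr_ge0 ?sqr_ge0//.
  rewrite ler_wpM2r ?exprn_ge0 ?(ltW (andP b01).1)//.
  rewrite (exprD x 2 2) ler_pM ?sqr_ge0//.
  apply: (@le_trans _ _ x); last by rewrite -{1}[x]mulr1 expr2 ler_wpM2l.
  by rewrite /x -natr1; have : 0 <= N%:R :> R by []; lra.
have -> : ((c1 + c2 + c3) * r ^+ l)%:E =
    ((c1 * r ^+ l)%:E + (c2 * r ^+ l)%:E + (c3 * r ^+ l)%:E)%E.
  by rewrite -!EFinD !mulrDl.
apply: leeD; first by apply: leeD => //; rewrite lee_fin.
apply: le_trans (square_tail_series_le R (2 * M) (2 * C) rho r3 K3 N _ r301 _ K30 H3 _ _) _.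
- by rewrite mulr_ge0.
- by move=> n; exact: measure_ge0.
- move=> n /=.
  apply: (@le_trans _ _ (P (meet_gt (pX (upper (Z l))) (pW (upper (Z l))) n) +
                         P (meet_gt (pX (lower (Z l))) (pW (lower (Z l))) n))%E).
    by apply: measureU2; exact: measurable_meet_gt.
  have -> : (2 * C * rho ^+ n)%:E = ((C * rho ^+ n)%:E + (C * rho ^+ n)%:E)%E.
    by rewrite -EFinD; congr _%:E; ring.
  by apply: leeD; [exact: tail1|exact: tail2].
rewrite lee_fin /c3 [leLHS]mulrAC ler_wpM2l//.
(* The tail starts at [N = l + k], and the surplus factor [r3 ^+ k] is at most 1. *)
apply: le_trans (r3r l); rewrite exprD ler_piMr ?exprn_ge0 ?exprn_ile1//; exact: ltW.
Qed.

End increment_rate.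

(** * Summing the levels and conclusion *)

Lemma meet_gt0 (Omega T : Type) (X W : nat -> Omega -> T) : meet_gt X W 0 = setT.
Proof. by apply/seteqP; split => w //= _ -[]. Qed.

Lemma cvg_telescope_series (R : realType) (a : nat -> R) (u : nat -> \bar R)
    (A : R) :
  u 0%N = (a 0%N)%:E -> (forall l, u l.+1 = (a l.+1 - a l)%:E) ->
  a @ \oo --> A -> (\sum_(0 <= l <oo) u l = A%:E)%E.
Proof.
move=> u0 uS aA.
have S n : (\sum_(0 <= l < n.+1) u l)%E = (a n)%:E.
  elim: n => [|n IH]; first by rewrite big_nat1.
  by rewrite big_nat_recr//= IH uS -EFinD addrC subrK.
apply/cvg_lim => //; rewrite -cvg_shiftS.
under eq_fun do rewrite S.
by apply: cvg_EFin => //; near=> n.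
Unshelve. all: by end_near.
Qed.

Lemma cvg_dist_geometric (R : realType) (a : nat -> R) (A K b : R) :
  0 < b < 1 -> (forall n, (0 < n)%N -> `|a n - A| <= K * b ^+ n) ->
  a @ \oo --> A.
Proof.
move=> /andP[b0 b1] H.
have c : (fun n => K * b ^+ n) @ \oo --> 0.
  by apply: cvg_geometric; rewrite ger0_norm// ltW.
apply/cvgrPdist_lt => e e0.
have /cvgrPdist_lt/(_ e e0) c' := c.
near=> n.
rewrite distrC; apply: le_lt_trans (H n _) _; first by near: n; exists 1%N.
apply: le_lt_trans (ler_norm _) _; rewrite -normrN -sub0r.
by near: n.
Unshelve. all: by end_near.
Qed.

Lemma EFin_Rintegral (R : realType) (d : measure_display)
    (T : measurableType d) (mu : {measure set T -> \bar R}) (f : T -> R) :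
  mu.-integrable setT (EFin \o f) ->
  (\int[mu]_x (f x)%:E = (\int[mu]_x f x)%:E)%E.
Proof.
by move=> fi; rewrite /Rintegral fineK//; exact: integrable_fin_num.
Qed.

Theorem theorem1
  (R : realType) (d : measure_display) (T : measurableType d)
  (dm : T -> T -> R)
  (dO : measure_display) (Omega : measurableType dO) (P : probability Omega R)
  (pi : probability T R) (pis : nat -> probability T R)
  (K : nat -> R.-pker T ~> T)
  (nu : nat -> probability T R) (nut : nat -> probability (T * T)%type R)
  (K0c : R.-pker (T * T)%type ~> (T * T)%type)
  (Kinc : nat -> R.-pker ((T * T) * (T * T))%type ~> ((T * T) * (T * T))%type)
  (Y0 : nat -> Omega -> T * T)
  (Z : nat -> nat -> Omega -> (T * T) * (T * T))
  (k : nat)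
  (* the metric space *)
  (Hmetric : is_metric dm)
  (Hdm_meas : measurable_fun setT (fun z : T * T => dm z.1 z.2))
  (Hdm_bdd : exists M : R, forall x w, dm x w <= M)
  (Hcompact : metric_compact dm)
  (* pi_l K_l = pi_l *)
  (Hinv : forall l (A : set T), measurable A ->
      (\int[pis l]_x K l x A = pis l A)%E)
  (* nu~_s has both marginals equal to nu_s *)
  (Hnut : forall s (A : set T), measurable A ->
      nut s (A `*` setT) = nu s A /\ nut s (setT `*` A) = nu s A)
  (* level-0 chain *)
  (HK0c : forall x w (A : set T), measurable A ->
      K0c (x, w) (A `*` setT) = K 0%N x A /\ K0c (x, w) (setT `*` A) = K 0%N w A)
  (HY0 : markov_chain P Y0 K0c)
  (HY0init : forall C : set (T * T), measurable C ->
      P (Y0 0%N @^-1` C) = check_nu (nut 0%N) (K 0%N) C)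
  (HY0faith : faithful (pX Y0) (pW Y0))
  (* increment chains *)
  (HKinc : forall l (z : (T * T) * (T * T)) (A : set T), (0 < l)%N -> measurable A ->
      [/\ Kinc l z [set z' | A z'.1.1] = K l z.1.1 A,
          Kinc l z [set z' | A z'.1.2] = K l z.1.2 A,
          Kinc l z [set z' | A z'.2.1] = K l.-1 z.2.1 A &
          Kinc l z [set z' | A z'.2.2] = K l.-1 z.2.2 A])
  (HZ : forall l, (0 < l)%N -> markov_chain P (Z l) (Kinc l))
  (HZinit : forall l (C : set (T * T)), (0 < l)%N -> measurable C ->
      P (upper (Z l) 0%N @^-1` C) = check_nu (nut l) (K l) C /\
      P (lower (Z l) 0%N @^-1` C) = check_nu (nut l.-1) (K l.-1) C)
  (HZfaith : forall l, (0 < l)%N ->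
      faithful (pX (upper (Z l))) (pW (upper (Z l))) /\
      faithful (pX (lower (Z l))) (pW (lower (Z l))))
  (* chains for different l (and the level-0 chain) are independent *)
  (Hindep : mutually_independent P
      (fun i : option nat => match i with
                             | None => proc_events Y0
                             | Some m => proc_events (Z m.+1)
                             end))
  (* (A1) *)
  (HA1 : exists (C rho : R), 0 < rho < 1 /\
      forall l x n (A : set T), (0 < n)%N -> measurable A ->
        (`| kiter (K l) n x A - pis l A | <= (C * rho ^+ n)%:E)%E)
  (* (A2) *)
  (HA2 : exists (C rho : R), 0 < rho < 1 /\
      (forall n, (0 < n)%N -> (P (meet_gt (pX Y0) (pW Y0) n) <= (C * rho ^+ n)%:E)%E) /\
      (forall l n, (0 < l)%N -> (0 < n)%N ->
        (P (meet_gt (pX (upper (Z l))) (pW (upper (Z l))) n) <= (C * rho ^+ n)%:E)%E /\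
        (P (meet_gt (pX (lower (Z l))) (pW (lower (Z l))) n) <= (C * rho ^+ n)%:E)%E))
  (* (A3) *)
  (HA3 : exists C : R, forall l (phi : T -> R),
      measurable_fun setT phi -> is_bounded_fun phi -> is_lipschitz dm phi ->
      forall x w,
        (`| kapp (K l) phi x - kapp (K l) phi w |
           <= (C * Num.max (sup_norm phi) (lip_norm dm phi) * dm x w)%:E)%E)
  (* (A4) *)
  (HA4 : exists (C beta1 : R), 0 < beta1 /\
      forall l (phi : T -> R), (0 < l)%N ->
        measurable_fun setT phi -> is_bounded_fun phi ->
        (`| (\int[pis l]_x (phi x)%:E) - (\int[pi]_x (phi x)%:E) |
           <= (C * sup_norm phi * Delta_pow l beta1)%:E)%E /\
        (forall x, (`| kapp (K l) phi x - kapp (K l.-1) phi x |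
           <= (C * sup_norm phi * Delta_pow l beta1)%:E)%E))
  (* (A5) *)
  (HA5 : exists (C beta2 eps : R), 0 < beta2 /\ 0 < eps /\
      forall l, (0 < l)%N ->
        (P (Z l 0%N @^-1` (~` B_set dm C beta2 l))
           <= (C * Delta_pow l (beta2 * (2 + eps)))%:E)%E /\
        (forall n, (0 < n)%N ->
          (P [set w | ~ B_set dm C beta2 l (Z l n w) /\ B_set dm C beta2 l (Z l n.-1 w)]
             <= (C * Delta_pow l (beta2 * (2 + eps)))%:E)%E)) :
  exists pL : nat -> R,
    (forall l, 0 < pL l) /\ (\sum_(0 <= l <oo) (pL l)%:E = 1)%E /\
    forall L : Omega -> nat,
      measurable_fun setT L ->
      (forall l, P (L @^-1` [set l]) = (pL l)%:E) ->
      (* L is independent of the level-0 chain and of all increment chains *)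
      (forall (Bs : set nat) (E : set Omega),
         family_events
           (fun i : option nat => match i with
                                  | None => proc_events Y0
                                  | Some m => proc_events (Z m.+1)
                                  end) E ->
         P (L @^-1` Bs `&` E) = (fine (P (L @^-1` Bs)) * fine (P E))%:E) ->
      forall phi : T -> R,
        measurable_fun setT phi -> is_bounded_fun phi -> is_lipschitz dm phi ->
        let est0 := estim phi (pX Y0) (pW Y0) k in
        let xi := fun l w =>
          estim phi (pX (upper (Z l))) (pW (upper (Z l))) k w
          - estim phi (pX (lower (Z l))) (pW (lower (Z l))) k w in
        let Yhat := fun w =>
          (pL (L w))^-1 * ((if L w == 0%N then est0 w else 0)
                           + (if (0 < L w)%N then xi (L w) w else 0)) in
        (\int[P]_w (Yhat w)%:E = \int[pi]_x (phi x)%:E)%E /\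
        (\int[P]_w ((Yhat w) ^+ 2)%:E < +oo)%E.
Proof.
have [C1 [rho1 [rho101 mix]]] := HA1.
have [C2 [rho [rho01 [tail0 tailZ]]]] := HA2.
have [C4 [beta1 [beta10 HA4']]] := HA4.
have [C5 [beta2 [eps [beta20 [eps0 HA5']]]]] := HA5.
(* The assumed tail bound starts at [n = 1]. At [n = 0] the event is the whole space, so the
   constant has to be at least 1; this also settles its sign. *)
pose C := Num.max C2 1.
have C0 : 0 <= C by rewrite le_max ler01 orbT.
have [rho0 rho1'] := andP rho01.
have tailC (X W : nat -> Omega -> T) :
    (forall n, (0 < n)%N -> (P (meet_gt X W n) <= (C2 * rho ^+ n)%:E)%E) ->
    forall n, (P (meet_gt X W n) <= (C * rho ^+ n)%:E)%E.
  move=> H [|n]; first by rewrite meet_gt0 probability_setT lee_fin expr0 mulr1 le_max lexx orbT.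
  apply: le_trans (H n.+1 isT) _; rewrite lee_fin ler_wpM2r ?exprn_ge0 ?(ltW rho0)//.
  by rewrite le_max lexx.
have tY := tailC _ _ tail0.
have tU l n : (0 < l)%N ->
    (P (meet_gt (pX (upper (Z l))) (pW (upper (Z l))) n) <= (C * rho ^+ n)%:E)%E.
  by move=> l0; apply: tailC => m m0; have [] := tailZ l m l0 m0.
have tL l n : (0 < l)%N ->
    (P (meet_gt (pX (lower (Z l))) (pW (lower (Z l))) n) <= (C * rho ^+ n)%:E)%E.
  by move=> l0; apply: tailC => m m0; have [] := tailZ l m l0 m0.
have mZ l n : (0 < l)%N -> measurable_fun setT (Z l n).
  by move=> l0; exact: (HZ l l0).1.
have [r [r01 rate]] := increment_rate R d dO T Omega P dm Z k C rho C5 beta2 eps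
  Hmetric Hdm_meas mZ C0 rho01 tU tL beta20 eps0 (fun l l0 => (HA5' l l0).1)
  (fun l n l0 n0 => (HA5' l l0).2 n n0).
have [r0 r1] := andP r01.
(* The ratio has to lie strictly between [r] and 1: below 1 to define a law, above [r] for
   [r ^+ l / q ^+ l] to be summable. With the square root this quotient is [q ^+ l]. *)
pose q := Num.sqrt r.
have q2 : q ^+ 2 = r by rewrite sqr_sqrtr// ltW.
have q0 : 0 < q by rewrite sqrtr_gt0.
have q1 : q < 1 by rewrite -sqrtr1 ltr_sqrt.
have q01 : 0 < q < 1 by rewrite q0.
have q1' : 0 < 1 - q by rewrite subr_gt0.
pose pL l := (1 - q) * q ^+ l.
have pL0 l : 0 < pL l by rewrite mulr_gt0// exprn_gt0.
exists pL; split => //; split; first exact: geometric_pmf.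
move=> L mL PL indep phi mphi bphi lphi est0 xi Yhat.
pose zeta l := if l is 0%N then est0 else xi l.
pose F := fun i : option nat => match i with
                             | None => proc_events Y0
                             | Some m => proc_events (Z m.+1)
                             end.
pose G := \bigcup_(i in setT) F i.
(* [Om'] is [Omega] with the sigma-algebra generated by the chains. Independence of [L] concerns its
   events only, so each [zeta l] must be measurable on [Om'], which is stronger than on [Omega]. *)
pose Om' := g_sigma_algebraType G.
have proc_measurable (d' : measure_display) (S : measurableType d')
    (V : nat -> Omega -> S) : (forall n, measurable_fun setT (V n)) ->
    proc_events V `<=` measurable.
  move=> mV; apply: smallest_sub; first exact: sigma_algebra_measurable.
  by move=> _ [n [A [mA ->]]]; rewrite -(setTI (_ @^-1` _)); exact: mV.
have Gm : G `<=` measurable.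
  by move=> E [[m|] _] /=; apply: proc_measurable => n; [exact: mZ|exact: HY0.1].
have proc_G (d' : measure_display) (S : measurableType d')
    (V : nat -> Omega -> S) i : F i = proc_events V ->
    forall n, measurable_fun (setT : set Om') (V n : Om' -> S).
  move=> FV n _ A mA; rewrite setTI; apply: sub_sigma_algebra.
  exists i => //; rewrite FV; apply: sub_sigma_algebra.
  by exists n, A.
have mestG (Q : nat -> Omega -> T * T) :
    (forall n, measurable_fun (setT : set Om') (Q n : Om' -> T * T)) ->
    measurable_fun (setT : set Om') (estim phi (pX Q) (pW Q) k : Om' -> R).
  move=> mQ.
  have m1 n : measurable_fun (setT : set Om') (pX Q n : Om' -> T).
    exact: (measurableT_comp measurable_fst (mQ n)).
  have m2 n : measurable_fun (setT : set Om') (pW Q n : Om' -> T).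
    exact: (measurableT_comp measurable_snd (mQ n)).
  apply: (measurable_estim _ _ _ _ Om') => // n.
  exact: (measurable_coincidence _ _ _ _ Om' dm).
have mZG l n : (0 < l)%N ->
    measurable_fun (setT : set Om') (Z l n : Om' -> (T * T) * (T * T)).
  by case: l => // l _; exact: (proc_G _ _ (Z l.+1) (Some l)).
have mz l : measurable_fun (setT : set Om') (zeta l : Om' -> R).
  case: l => [|l] /=; first by apply: mestG; exact: (proc_G _ _ Y0 None).
  apply: measurable_funB; apply: mestG => n.
  - exact: (measurableT_comp measurable_fst (mZG l.+1 n isT)).
  - exact: (measurableT_comp measurable_snd (mZG l.+1 n isT)).
have [c [c0 rate_c]] := rate phi mphi bphi lphi.
have HK1 z A : measurable A -> K0c z ((fun z' => z'.1) @^-1` A) = K 0%N z.1 A.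
  case: z => x w mA; rewrite -(HK0c x w A mA).1; congr (K0c _ _).
  by apply/seteqP; split => z //= [].
have HK2 z A : measurable A -> K0c z ((fun z' => z'.2) @^-1` A) = K 0%N z.2 A.
  case: z => x w mA; rewrite -(HK0c x w A mA).2; congr (K0c _ _).
  by apply/seteqP; split => z //= [].
have mid : measurable_fun setT (@id (T * T)) by [].
have mest (Q : nat -> Omega -> T * T) : (forall n, measurable_fun setT (Q n)) ->
    (forall n, (P (meet_gt (pX Q) (pW Q) n) <= (C * rho ^+ n)%:E)%E) ->
    (\int[P]_w (estim phi (pX Q) (pW Q) k w ^+ 2)%:E < +oo)%E /\
    P.-integrable setT (EFin \o estim phi (pX Q) (pW Q) k).
  move=> mQ tQ.
  have m1 n : measurable_fun setT (pX Q n).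
    exact: (measurableT_comp measurable_fst (mQ n)).
  have m2 n : measurable_fun setT (pW Q n).
    exact: (measurableT_comp measurable_snd (mQ n)).
  have m3 n := measurable_coincidence _ _ _ _ _ dm _ _ Hmetric Hdm_meas (m1 n) (m2 n).
  split; first exact: (estim_sq_integral_lty _ _ _ _ _ _ _ _ C rho).
  exact: (estim_integrable _ _ _ _ _ _ _ _ C rho).
have [est0_sq est0_int] := mest Y0 HY0.1 tY.
pose v0 := fine (\int[P]_w (est0 w ^+ 2)%:E)%E.
have v0E : (\int[P]_w (est0 w ^+ 2)%:E = v0%:E)%E.
  rewrite /v0 fineK// ge0_fin_numE//.
  by apply: integral_ge0 => w _; rewrite lee_fin sqr_ge0.
have v00 : 0 <= v0.
  by rewrite -lee_fin -v0E; apply: integral_ge0 => w _; rewrite lee_fin sqr_ge0.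
(* The rate covers the levels from 1 on; the finite second moment [v0] of level 0 is added to the
   constant, where [r ^+ 0 = 1] leaves it intact. *)
have zc l : (\int[P]_w (zeta l w ^+ 2)%:E <= ((v0 + c) * r ^+ l)%:E)%E.
  case: l => [|l] /=; first by rewrite v0E lee_fin expr0 mulr1 lerDl.
  apply: le_trans (rate_c l.+1 isT) _; rewrite lee_fin ler_wpM2r ?lerDr//.
  by rewrite exprn_ge0// ltW.
have csum : (\sum_(0 <= l <oo) ((pL l)^-1 * ((v0 + c) * r ^+ l))%:E < +oo)%E.
  have cE l : (pL l)^-1 * ((v0 + c) * r ^+ l) = (v0 + c) / (1 - q) * q ^+ l.
    rewrite /pL -q2 -exprM mulnC exprM; field.
    by apply/andP; split; apply: lt0r_neq0; rewrite ?exprn_gt0.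
  have K0 : 0 <= (v0 + c) / (1 - q).
    by apply: divr_ge0; [exact: addr_ge0|exact: ltW].
  apply: le_lt_trans (@eseries_geometric_le R ((v0 + c) / (1 - q)) q 0 _ K0 q01 _ _) _.
  - by move=> l; rewrite lee_fin cE mulr_ge0// exprn_ge0// ltW.
  - by move=> l _; rewrite cE.
  - exact: ltry.
have [Y2 EY] := single_term_estimator R dO Omega P G L pL zeta
  (fun l => (v0 + c) * r ^+ l) Gm mL pL0 PL indep mz zc csum.
have YhatE w : Yhat w = (pL (L w))^-1 * zeta (L w) w.
  by rewrite /Yhat /zeta; case: (L w) => [|l] /=; rewrite ?addr0 ?add0r.
split; last by under eq_integral do rewrite YhatE.
under eq_integral do rewrite YhatE.
rewrite EY {Y2 EY}.
pose a l := \int[pis l]_x phi x.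
have [M phiM] := bphi.
have phi_int (mu : probability T R) : mu.-integrable setT (EFin \o phi).
  exact: (bounded_fun_integrable _ _ _ _ _ M).
have E0 : \int[P]_w est0 w = a 0%N.
  exact: (level_unbiased R d _ dO T _ Omega P (K 0%N) K0c id Y0 (pis 0%N) (nu 0%N)
    (nut 0%N) mid HK1 HK2 HY0 HY0init (Hnut 0%N) C1 rho1 C rho dm rho101
    (mix 0%N) Hmetric Hdm_meas C0 rho01 tY HY0faith phi k mphi bphi).
have Eup l : (0 < l)%N ->
    \int[P]_w estim phi (pX (upper (Z l))) (pW (upper (Z l))) k w = a l.
  move=> l0.
  apply: (level_unbiased R d _ dO T _ Omega P (K l) (Kinc l) fst (Z l) (pis l) (nu l)
    (nut l) measurable_fst _ _ (HZ l l0) _ (Hnut l) C1 rho1 C rho dm rho101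
    (mix l) Hmetric Hdm_meas C0 rho01 _ (HZfaith l l0).1 phi k mphi bphi).
  - by move=> z A mA; have [H _ _ _] := HKinc l z A l0 mA.
  - by move=> z A mA; have [_ H _ _] := HKinc l z A l0 mA.
  - by move=> D mD; exact: (HZinit l D l0 mD).1.
  - by move=> n; exact: tU.
have Elo l : (0 < l)%N ->
    \int[P]_w estim phi (pX (lower (Z l))) (pW (lower (Z l))) k w = a l.-1.
  move=> l0.
  apply: (level_unbiased R d _ dO T _ Omega P (K l.-1) (Kinc l) snd (Z l) (pis l.-1)
    (nu l.-1) (nut l.-1) measurable_snd _ _ (HZ l l0) _ (Hnut l.-1) C1 rho1 C rho dm
    rho101 (mix l.-1) Hmetric Hdm_meas C0 rho01 _ (HZfaith l l0).2 phi k mphi bphi).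
  - by move=> z A mA; have [_ _ H _] := HKinc l z A l0 mA.
  - by move=> z A mA; have [_ _ _ H] := HKinc l z A l0 mA.
  - by move=> D mD; exact: (HZinit l D l0 mD).2.
  - by move=> n; exact: tL.
rewrite (EFin_Rintegral _ _ _ _ _ (phi_int pi)).
apply: (cvg_telescope_series _ a).
- by rewrite /= EFin_Rintegral// E0.
- move=> l; rewrite /=.
  have [_ iu] := mest (upper (Z l.+1))
    (fun n => measurableT_comp measurable_fst (mZ l.+1 n isT)) (fun n => tU l.+1 n isT).
  have [_ il] := mest (lower (Z l.+1))
    (fun n => measurableT_comp measurable_snd (mZ l.+1 n isT)) (fun n => tL l.+1 n isT).
  rewrite EFin_Rintegral; last exact: integrable_EFinB.
  by rewrite RintegralB// Eup// Elo.
(* The partial sums of the means have telescoped to [a n]; the bias bound in [HA4] takes these to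
   the integral of [phi] against [pi]. *)
apply: (cvg_dist_geometric _ a _ (C4 * sup_norm phi) (2^-1 `^ beta1)).
  exact: half_powR_lt1.
move=> n n0; have := (HA4' n phi n0 mphi bphi).1.
rewrite (EFin_Rintegral _ _ _ _ _ (phi_int (pis n))) (EFin_Rintegral _ _ _ _ _ (phi_int pi)).
by rewrite -EFinB lee_fin Delta_powE.
Qed.
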